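(* Let $H$ and $K$ be connected cocommutative Hopf algebras such that $K$ is an $H$-module bialgebra via an action $\rightharpoonup: H\to \mathrm{End}(K)$, and let $\pi:H\to K$ be a Hopf algebra crossed homomorphism with respect to $\rightharpoonup$. Let $i_H:P(H)\to H$, $i_K:P(K)\to K$, $j_H:P(H)\to U(P(H))$, $j_K:P(K)\to U(P(K))$ be the inclusions and let $\varphi_H:U(P(H))\to H$, $\varphi_K:U(P(K))\to K$ be the Milnor-Moore Hopf algebra isomorphisms. Then $\pi$ induces a unique Hopf algebra crossed homomorphism $\bar\pi:U(P(H))\to U(P(K))$ (with respect to the extended action of $U(P(H))$ on $U(P(K))$) such that the diagram of crossed homomorphisms and inclusions is commutative, i.e. $$i_K\circ \pi|_{P(H)}=\pi\circ i_H,\quad j_K\circ\pi|_{P(H)}=\bar\pi\circ j_H,\quad \varphi_H\circ j_H=i_H,\quad \varphi_K\circ j_K=i_K,\quad \varphi_K\circ\bar\pi=\pi\circ\varphi_H .$$ Moreover, $\varphi_H$ and $\varphi_K$ give an isomorphism between the Hopf algebra crossed homomorphisms $\pi:H\to K$ and $\bar\pi:U(P(H))\to U(P(K))$; that is, $\varphi_H,\varphi_K$ are Hopf algebra isomorphisms with $\varphi_K\bar\pi=\pi\varphi_H$ and $\varphi_K(u\rightharpoonup v)=\varphi_H(u)\rightharpoonup\varphi_K(v)$ for all $u\in U(P(H))$, $v\in U(P(K))$.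
   Context: Everything is over a field $\mathbf{k}$ of characteristic $0$. Sweedler notation: $\Delta(a)=a_1\otimes a_2$. $P(H)=\{c\in H:\Delta(c)=c\otimes 1+1\otimes c\}$ is the Lie algebra of primitive elements; $U(\cdot)$ is the universal enveloping algebra. $K$ is an $H$-module algebra via an algebra action $\rightharpoonup:H\to\mathrm{End}(K)$ if $a\rightharpoonup 1=\varepsilon(a)1$ and $a\rightharpoonup(xy)=(a_1\rightharpoonup x)(a_2\rightharpoonup y)$; it is an $H$-module bialgebra if moreover $\varepsilon_K(a\rightharpoonup x)=\varepsilon_H(a)\varepsilon_K(x)$ and $\Delta_K(a\rightharpoonup x)=(a_1\rightharpoonup x_1)\otimes(a_2\rightharpoonup x_2)$, for all $a\in H$, $x,y\in K$. A Hopf algebra crossed homomorphism $\pi:H\to K$ with respect to $\rightharpoonup$ is a coalgebra homomorphism with $\pi(ab)=\pi(a_1)(a_2\rightharpoonup\pi(b))$ for all $a,b\in H$. A homomorphism from a crossed homomorphism $\pi:H\to K$ to $\pi':H'\to K'$ is a pair of Hopf algebra homomorphisms $f:K\to K'$, $g:H\to H'$ with $f\pi=\pi' g$ and $f(a\rightharpoonup x)=g(a)\rightharpoonup f(x)$. The action $\rightharpoonup$ restricts to an action $P(H)\to\mathrm{Der}(P(K))$ of the Lie algebra $P(H)$ on the Lie algebra $P(K)$ by derivations, and $\pi$ restricts to a linear map $\pi|_{P(H)}:P(H)\to P(K)$. The extended action of $U(P(H))$ on $U(P(K))$ is the algebra action in which $x\in P(H)$ acts by $x\rightharpoonup 1=0$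 and $x\rightharpoonup (y_1\cdots y_r)=\sum_{i=1}^r y_1\cdots y_{i-1}(x\rightharpoonup y_i)y_{i+1}\cdots y_r$ for $y_i\in P(K)$; it is a module bialgebra action. The Milnor-Moore isomorphism $\varphi_H:U(P(H))\to H$ is the unique algebra homomorphism extending the inclusion $P(H)\to H$; it is a Hopf algebra isomorphism for $H$ connected cocommutative. *)

(* Defs.v *)
From HB Require Import structures.
From mathcomp Require Import all_boot all_algebra.
From mathcomp Require Import boolp classical_sets.

Set Implicit Arguments.
Unset Strict Implicit.
Unset Printing Implicit Defensive.

Import GRing.Theory.
Local Open Scope ring_scope.
Local Open Scope quotient_scope.

Local Notation bilin f := (bilinear_for *:%R *:%R f).

(* The tensor product is the k-module presented by the generators v ⊗ w and
   the bilinearity relations: terms modulo the least congruence containing the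
   module axioms and these relations. *)
Section Tensor.
Variables (k : fieldType) (V W : lmodType k).

Inductive tterm : Type :=
| TZero | TPure of V & W | TAdd of tterm & tterm | TOpp of tterm
| TScale of k & tterm.

Inductive teq : tterm -> tterm -> Prop :=
| teq_refl s : teq s s
| teq_sym s t : teq s t -> teq t s
| teq_trans s t u : teq s t -> teq t u -> teq s u
| teq_add s s' t t' : teq s s' -> teq t t' -> teq (TAdd s t) (TAdd s' t')
| teq_opp s s' : teq s s' -> teq (TOpp s) (TOpp s')
| teq_scale c s s' : teq s s' -> teq (TScale c s) (TScale c s')
| teq_addA s t u : teq (TAdd s (TAdd t u)) (TAdd (TAdd s t) u)
| teq_addC s t : teq (TAdd s t) (TAdd t s)
| teq_add0 s : teq (TAdd TZero s) s
| teq_addN s : teq (TAdd (TOpp s) s) TZero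
| teq_scaleA a b s : teq (TScale a (TScale b s)) (TScale (a * b) s)
| teq_scale1 s : teq (TScale 1 s) s
| teq_scaleDr a s t : teq (TScale a (TAdd s t)) (TAdd (TScale a s) (TScale a t))
| teq_scaleDl a b s : teq (TScale (a + b) s) (TAdd (TScale a s) (TScale b s))
| teq_pureDl v v' w : teq (TPure (v + v') w) (TAdd (TPure v w) (TPure v' w))
| teq_pureDr v w w' : teq (TPure v (w + w')) (TAdd (TPure v w) (TPure v w'))
| teq_pureZl c v w : teq (TPure (c *: v) w) (TScale c (TPure v w))
| teq_pureZr c v w : teq (TPure v (c *: w)) (TScale c (TPure v w)).

HB.instance Definition _ := gen_eqMixin tterm.
HB.instance Definition _ := gen_choiceMixin tterm.

Let teqb s t := `[< teq s t >].
Let teqb_refl : reflexive teqb.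
Proof. by move=> s; apply/asboolP; exact: teq_refl. Qed.
Let teqb_sym : symmetric teqb.
Proof. by move=> s t; apply/asboolP/asboolP; exact: teq_sym. Qed.
Let teqb_trans : transitive teqb.
Proof.
by move=> t s u /asboolP st /asboolP tu; apply/asboolP; exact: teq_trans st tu.
Qed.
Definition teq_equiv : equiv_rel tterm := EquivRel teqb teqb_refl teqb_sym teqb_trans.

Definition tensor : Type := {eq_quot teq_equiv}.
HB.instance Definition _ := Choice.on tensor.
HB.instance Definition _ := EqQuotient.on tensor.

Definition tpi (t : tterm) : tensor := \pi_({eq_quot teq_equiv}) t.

Let tpiP s t : teq s t -> tpi s = tpi t.
Proof. by move=> st; apply/eqmodP/asboolP. Qed.

Let tpiE s t : tpi s = tpi t -> teq s t.
Proof. by move=> /eqmodP/asboolP. Qed.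

Let treprK (x : tensor) : tpi (repr x) = x.
Proof. exact: reprK. Qed.

Let tpi_repr t : teq (repr (tpi t)) t.
Proof. by apply: tpiE; rewrite treprK. Qed.

Definition tzero : tensor := tpi TZero.
Definition tadd (x y : tensor) : tensor := tpi (TAdd (repr x) (repr y)).
Definition topp (x : tensor) : tensor := tpi (TOpp (repr x)).
Definition tscale (c : k) (x : tensor) : tensor := tpi (TScale c (repr x)).
Definition tens (v : V) (w : W) : tensor := tpi (TPure v w).

Let tpiD s t : tadd (tpi s) (tpi t) = tpi (TAdd s t).
Proof. by apply: tpiP; apply: teq_add; exact: tpi_repr. Qed.
Let tpiN s : topp (tpi s) = tpi (TOpp s).
Proof. by apply: tpiP; apply: teq_opp; exact: tpi_repr. Qed.
Let tpiZ c s : tscale c (tpi s) = tpi (TScale c s).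
Proof. by apply: tpiP; apply: teq_scale; exact: tpi_repr. Qed.

Let taddA : associative tadd.
Proof.
move=> x y z; rewrite -(treprK x) -(treprK y) -(treprK z) !tpiD.
by apply: tpiP; exact: teq_addA.
Qed.
Let taddC : commutative tadd.
Proof.
by move=> x y; rewrite -(treprK x) -(treprK y) !tpiD; apply/tpiP/teq_addC.
Qed.
Let tadd0 : left_id tzero tadd.
Proof. by move=> x; rewrite -(treprK x) tpiD; apply/tpiP/teq_add0. Qed.
Let taddN : left_inverse tzero topp tadd.
Proof. by move=> x; rewrite -(treprK x) tpiN tpiD; apply/tpiP/teq_addN. Qed.

HB.instance Definition _ := GRing.isZmodule.Build tensor taddA taddC tadd0 taddN.

Let tscaleA a b x : tscale a (tscale b x) = tscale (a * b) x.
Proof. by rewrite -(treprK x) !tpiZ; apply/tpiP/teq_scaleA. Qed.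
Let tscale1 : left_id 1 tscale.
Proof. by move=> x; rewrite -(treprK x) !tpiZ; apply/tpiP/teq_scale1. Qed.
Let tscaleDr : right_distributive tscale +%R.
Proof.
move=> a x y; rewrite -(treprK x) -(treprK y) -[+%R]/tadd.
by rewrite !(tpiD, tpiZ); apply/tpiP/teq_scaleDr.
Qed.
Let tscaleDl x : {morph tscale^~ x : a b / a + b}.
Proof.
move=> a b; rewrite -(treprK x) -[+%R in RHS]/tadd !(tpiD, tpiZ).
exact/tpiP/teq_scaleDl.
Qed.

HB.instance Definition _ :=
  GRing.Zmodule_isLmodule.Build k tensor tscaleA tscale1 tscaleDr tscaleDl.

Lemma tensDl v v' w : tens (v + v') w = tens v w + tens v' w.
Proof. by rewrite [RHS]tpiD; apply/tpiP/teq_pureDl. Qed.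
Lemma tensDr v w w' : tens v (w + w') = tens v w + tens v w'.
Proof. by rewrite [RHS]tpiD; apply/tpiP/teq_pureDr. Qed.
Lemma tensZl c v w : tens (c *: v) w = c *: tens v w.
Proof. by rewrite [RHS]tpiZ; apply/tpiP/teq_pureZl. Qed.
Lemma tensZr c v w : tens v (c *: w) = c *: tens v w.
Proof. by rewrite [RHS]tpiZ; apply/tpiP/teq_pureZr. Qed.
Lemma tens_bilin : bilin tens.
Proof. by split=> ? ? ? ?; rewrite (tensDl, tensDr) (tensZl, tensZr). Qed.
Lemma tens0 v : tens v 0 = 0.
Proof. by rewrite -[X in tens _ X](scale0r 0) tensZr scale0r. Qed.
Lemma t0ens w : tens 0 w = 0.
Proof. by rewrite -[X in tens X _](scale0r 0) tensZl scale0r. Qed.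

Lemma tensor_ind (P : tensor -> Prop) :
  (forall v w, P (tens v w)) -> (forall x y, P x -> P y -> P (x + y)) ->
  forall x, P x.
Proof.
move=> Pp Pa x; rewrite -[x]scale1r -(treprK x).
elim: (repr x) (1 : k) => [|v w|s IHs t IHt|s IHs|b s IHs] c.
- have -> : tpi TZero = 0 by [].
  by rewrite scaler0 -(tens0 0).
- by rewrite -[tpi _]/(tens v w) -tensZl.
- by rewrite -tpiD scalerDr; exact: Pa.
- by rewrite -tpiN -[topp _]/(- tpi s) scalerN -scaleNr.
- by rewrite -tpiZ -[tscale _ _]/(b *: tpi s) scalerA.
Qed.

Section Lift.
Variable X : lmodType k.
Implicit Types f g : V -> W -> X.

Fixpoint teval f (t : tterm) : X :=
  match t with
  | TZero => 0
  | TPure v w => f v w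
  | TAdd s t => teval f s + teval f t
  | TOpp s => - teval f s
  | TScale c s => c *: teval f s
  end.

(* For bilinear f, the linear map sending v ⊗ w to f v w (see tlift_tens and
   tlift_is_linear); for other f the value depends on chosen representatives. *)
Definition tlift f (x : tensor) : X := teval f (repr x).

Let teval_compat f : bilin f -> forall s t, teq s t -> teval f s = teval f t.
Proof.
move=> [f1 f2] s t; elim=> //=; try by move=> *; congruence.
- by move=> *; rewrite addrA.
- by move=> *; rewrite addrC.
- by move=> *; rewrite add0r.
- by move=> *; rewrite addNr.
- by move=> *; rewrite scalerA.
- by move=> *; rewrite scale1r.
- by move=> *; rewrite scalerDr.
- by move=> *; rewrite scalerDl.
- by move=> v v' w; have /= := f1 w 1 v v'; rewrite !scale1r.
- by move=> v w w'; have /= := f2 v 1 w w'; rewrite !scale1r.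
- by move=> c v w; exact: (scalable_linear (f1 w)).
- by move=> c v w; exact: (scalable_linear (f2 v)).
Qed.

Let tlift_pi f : bilin f -> forall t, tlift f (tpi t) = teval f t.
Proof. by move=> bf t; apply: teval_compat => //; exact: tpi_repr. Qed.

Lemma tlift_tens f v w : bilin f -> tlift f (tens v w) = f v w.
Proof. by move=> bf; rewrite tlift_pi. Qed.

Lemma tlift_is_linear f : bilin f -> linear (tlift f).
Proof.
move=> bf c x y; rewrite -(treprK x) -(treprK y) -[_ *: _]/(tscale _ _) tpiZ.
by rewrite [X in tlift f X]tpiD !(tlift_pi bf).
Qed.

Lemma tliftD f x y : bilin f -> tlift f (x + y) = tlift f x + tlift f y.
Proof. by move=> bf; have := tlift_is_linear bf 1 x y; rewrite !scale1r. Qed.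

Lemma tliftZ f c x : bilin f -> tlift f (c *: x) = c *: tlift f x.
Proof. by move=> bf; exact: (scalable_linear (tlift_is_linear bf)).
Qed.

Lemma eq_tlift f g x : f =2 g -> tlift f x = tlift g x.
Proof. by move=> fg; congr (tlift _ x); apply/funext=> v; apply/funext=> w. Qed.

Lemma tlift_addf f g x :
  tlift (fun v w => f v w + g v w) x = tlift f x + tlift g x.
Proof.
rewrite /tlift; elim: (repr x) => [|v w|s IHs t IHt|s IHs|b s IHs] //=.
- by rewrite addr0.
- by rewrite IHs IHt addrACA.
- by rewrite IHs opprD.
- by rewrite IHs scalerDr.
Qed.

Lemma tlift_scalef f c x :
  tlift (fun v w => c *: f v w) x = c *: tlift f x.
Proof.
rewrite /tlift; elim: (repr x) => [|v w|s IHs t IHt|s IHs|b s IHs] //=.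
- by rewrite scaler0.
- by rewrite IHs IHt scalerDr.
- by rewrite IHs scalerN.
- by rewrite IHs !scalerA mulrC.
Qed.

End Lift.

Lemma linear_tlift (X Y : lmodType k) (h : X -> Y) (f : V -> W -> X) x :
  linear h -> h (tlift f x) = tlift (fun v w => h (f v w)) x.
Proof.
move=> hl; have hZ c u : h (c *: u) = c *: h u by exact: (scalable_linear hl).
have h0 : h 0 = 0 by rewrite -(scale0r 0) hZ scale0r.
have hD u v : h (u + v) = h u + h v by have := hl 1 u v; rewrite !scale1r.
rewrite /tlift; elim: (repr x) => [|v w|s IHs t IHt|s IHs|b s IHs] //=.
- by rewrite hD IHs IHt.
- by rewrite -scaleN1r hZ IHs scaleN1r.
- by rewrite hZ IHs.
Qed.

Lemma tensor_ext (X : lmodType k) (f g : tensor -> X) :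
  linear f -> linear g -> (forall v w, f (tens v w) = g (tens v w)) -> f =1 g.
Proof.
move=> fl gl fg; elim/tensor_ind => // x y fx fy.
by have := fl 1 x y; have := gl 1 x y; rewrite !scale1r => -> ->; rewrite fx fy.
Qed.

End Tensor.

Arguments tlift {k V W X}.

Notation "v ⊗ w" := (tens v w) (at level 45, left associativity) : ring_scope.
Notation "V ⊗ W" := (tensor V W) (at level 45, left associativity) : type_scope.

(* Sweedler notation: for t = Σ a ⊗ b, this is Σ E(a, b), for E bilinear. *)
Notation "\sw_ ( a , b <- t ) E" := (tlift (fun a b => E) t)
  (at level 46, a name, b name, t at level 100, E at level 46,
   format "'[' \sw_ ( a ,  b  <-  t ) '/  '  E ']'") : ring_scope.

Section LinearForm.
Variables (k : fieldType) (V : lmodType k).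

Lemma exists_linear_form (v0 : V) : v0 != 0 ->
  exists2 f : V -> k, scalar f & f v0 = 1.
Proof.
move=> v0N0.
pose P (M : set V) := (forall a x y, M x -> M y -> M (a *: x + y)) /\ ~ M v0.
have [F FP totF|M [[Mlin Mv0] Mmax]] := @Zorn_bigcup V P.
  split=> [a x y [A FA Ax] [B FB By]|[A FA Av0]]; last by case: (FP _ FA).
  have [AB|BA] := totF A B FA FB.
    by exists B => //; apply: (FP _ FB).1 => //; exact: AB.
  by exists A => //; apply: (FP _ FA).1 => //; exact: BA.
have M0 : M 0.
  have [[x Mx]|Mn] := pselect (exists x, M x).
    by have := Mlin (-1) x x Mx Mx; rewrite scaleN1r addNr.
  exfalso; apply: (Mmax (fun x => x = 0)).
    by split=> [x Mx|sub]; [case: Mn; exists x | apply: Mn; exists 0; exact: sub].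
  split=> [a x y -> ->|v00]; first by rewrite scaler0 addr0.
  by rewrite v00 eqxx in v0N0.
have MZ a x : M x -> M (a *: x) by move=> Mx; rewrite -[_ *: _]addr0; exact: Mlin.
have MD x y : M x -> M y -> M (x + y) by rewrite -{2}[x]scale1r; exact: Mlin.
have Mc w : exists c, M (w - c *: v0).
  have [Mw|MNw] := pselect (M w); first by exists 0; rewrite scale0r subr0.
  have nP : ~ P (fun x => exists m a, M m /\ x = m + a *: w).
    apply: Mmax; split=> [x Mx|sub].
      by exists x, 0; rewrite scale0r addr0.
    by apply: MNw; apply: sub; exists 0, 1; rewrite add0r scale1r.
  have [m [a [Mm v0E]]] : exists m a, M m /\ v0 = m + a *: w.
    apply: contrapT => nv; apply: nP; split=> //.
    move=> b x y [m [a [Mm ->]]] [m' [a' [Mm' ->]]].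
    exists (b *: m + m'), (b * a + a'); split; first exact: Mlin.
    by rewrite scalerDr scalerA scalerDl addrACA.
  have [a0|aN0] := eqVneq a 0.
    by case: Mv0; rewrite v0E a0 scale0r addr0.
  exists a^-1; have -> : w - a^-1 *: v0 = (- a^-1) *: m.
    by rewrite v0E scalerDr scalerA mulVf // scale1r opprD addrCA subrr addr0 scaleNr.
  exact: MZ.
have Mu c c' w : M (w - c *: v0) -> M (w - c' *: v0) -> c = c'.
  move=> h h'; apply: contrapT => /eqP; rewrite -subr_eq0 => cN0.
  have := Mlin (-1) _ _ h h'; rewrite scaleN1r opprB addrA subrK -scalerBl.
  by move=> /(MZ (c - c')^-1); rewrite scalerA mulVf // scale1r.
pose f w := projT1 (cid (Mc w)).
have fP w : M (w - f w *: v0) by exact: projT2 (cid (Mc w)).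
exists f.
  move=> a x y; apply: (Mu _ _ _ (fP _)).
  have := Mlin a _ _ (fP x) (fP y).
  by rewrite scalerBr scalerA addrACA -opprD -scalerDl.
by apply: (Mu _ _ _ (fP _)); rewrite scale1r subrr.
Qed.

End LinearForm.

Section TensorAlgebra.
Variables (k : fieldType) (A B : algType k).

Definition tone : A ⊗ B := 1 ⊗ 1.
Definition tmul (x y : A ⊗ B) : A ⊗ B :=
  \sw_(a, b <- x) \sw_(c, d <- y) (a * c) ⊗ (b * d).

Let inner_bilin (a : A) (b : B) : bilin (fun c d => (a * c) ⊗ (b * d)).
Proof. by split=> ? ? ? ? /=; rewrite mulrDr -scalerAr (tensDl,tensDr) (tensZl,tensZr). Qed.

Let outer_bilin (y : A ⊗ B) :
  bilin (fun a b => \sw_(c, d <- y) (a * c) ⊗ (b * d)).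
Proof.
split=> u c v w /=; rewrite -tlift_scalef -tlift_addf; apply: eq_tlift => ? ?;
by rewrite mulrDl -scalerAl (tensDl,tensDr) (tensZl,tensZr).
Qed.

Lemma tmul_tens a b c d : tmul (a ⊗ b) (c ⊗ d) = (a * c) ⊗ (b * d).
Proof. by rewrite /tmul tlift_tens ?tlift_tens. Qed.

Let tmulDl : left_distributive tmul +%R.
Proof. by move=> x y z; rewrite /tmul tliftD. Qed.
Let tmulDr : right_distributive tmul +%R.
Proof.
by move=> x y z; rewrite /tmul -tlift_addf; apply: eq_tlift => ? ?; rewrite tliftD.
Qed.
Let tmulZl c x y : tmul (c *: x) y = c *: tmul x y.
Proof. by rewrite /tmul tliftZ. Qed.
Let tmulZr c x y : tmul x (c *: y) = c *: tmul x y.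
Proof. by rewrite /tmul -tlift_scalef; apply: eq_tlift => ? ?; rewrite tliftZ. Qed.

Let tmulA : associative tmul.
Proof.
move=> x y z; elim/tensor_ind: x => [a b|x x' IH IH']; last first.
  by rewrite !tmulDl IH IH'.
elim/tensor_ind: y => [c d|y y' IH IH']; last by rewrite !(tmulDl, tmulDr) IH IH'.
elim/tensor_ind: z => [e f|z z' IH IH']; last by rewrite !tmulDr IH IH'.
by rewrite !tmul_tens !mulrA.
Qed.
Let tmul1l : left_id tone tmul.
Proof.
elim/tensor_ind => [a b|x y IHx IHy]; last by rewrite tmulDr IHx IHy.
by rewrite tmul_tens !mul1r.
Qed.
Let tmul1r : right_id tone tmul.
Proof.
elim/tensor_ind => [a b|x y IHx IHy]; last by rewrite tmulDl IHx IHy.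
by rewrite tmul_tens !mulr1.
Qed.
Let tone_neq0 : tone != 0.
Proof.
have [f fl f1] := exists_linear_form (oner_neq0 A).
have [g gl g1] := exists_linear_form (oner_neq0 B).
pose h (a : A) (b : B) : k^o := f a * g b.
have bh : bilin h.
  split=> u c v w; rewrite /h /=.
    by rewrite fl mulrDl -mulrA.
  by rewrite gl mulrDr mulrCA.
apply/eqP => /(congr1 (tlift h)); rewrite tlift_tens // -(scale0r (0 : A ⊗ B)).
by rewrite tliftZ // scale0r /h f1 g1 mulr1 => /eqP; rewrite oner_eq0.
Qed.

HB.instance Definition _ := GRing.Zmodule_isNzRing.Build (tensor A B)
  tmulA tmul1l tmul1r tmulDl tmulDr tone_neq0.
HB.instance Definition _ := GRing.Lmodule_isLalgebra.Build k (tensor A B)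
  (fun c x y => esym (tmulZl c x y)).
HB.instance Definition _ := GRing.Lalgebra_isAlgebra.Build k (tensor A B)
  (fun c x y => esym (tmulZr c x y)).

Lemma tens1 : 1 ⊗ 1 = 1 :> A ⊗ B. Proof. by []. Qed.
Lemma tensM (a c : A) (b d : B) : (a ⊗ b) * (c ⊗ d) = (a * c) ⊗ (b * d).
Proof. exact: tmul_tens. Qed.
End TensorAlgebra.

Section SweedlerCalculus.
Variable k : fieldType.

Lemma bilin_sw (V W V' W' X : lmodType k) (F : V -> W -> V' -> W' -> X) t :
  (forall c d, bilin (fun a b => F a b c d)) ->
  bilin (fun a b => \sw_(c, d <- t) F a b c d).
Proof.
move=> bF; split=> u c v w /=; rewrite -tlift_scalef -tlift_addf;
  apply: eq_tlift => x y; [exact: (bF x y).1 | exact: (bF x y).2].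
Qed.

Lemma bilin_comp (V W V' W' X : lmodType k) (F : V' -> W' -> X)
    (f : V -> V') (g : W -> W') :
  bilin F -> linear f -> linear g -> bilin (fun a b => F (f a) (g b)).
Proof.
move=> bF fl gl; split=> u c v w /=.
  by rewrite fl; exact: (bF.1 (g u)).
by rewrite gl; exact: (bF.2 (f u)).
Qed.

Lemma bilin_post (V W X Y : lmodType k) (F : V -> W -> X) (h : X -> Y) :
  bilin F -> linear h -> bilin (fun a b => h (F a b)).
Proof.
move=> bF hl; split=> u c v w /=; rewrite -hl; congr h.
  exact: (bF.1 u).
exact: (bF.2 u).
Qed.

Lemma tlift_pureD (V W X : lmodType k) (f : V -> W -> X) v w v' w' :
  bilin f -> \sw_(a, b <- v ⊗ w + v' ⊗ w') f a b = f v w + f v' w'.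
Proof. by move=> bf; rewrite tliftD // !tlift_tens. Qed.

Lemma sw_sw (V W V' W' X : lmodType k) (F : V' -> W' -> X) (G : V -> W -> V' ⊗ W') t :
  bilin F -> tlift F (tlift G t) = \sw_(a, b <- t) tlift F (G a b).
Proof. by move=> bF; rewrite (linear_tlift _ _ (tlift_is_linear bF)). Qed.

Lemma sw_id (V W : lmodType k) (t : V ⊗ W) : \sw_(a, b <- t) a ⊗ b = t.
Proof.
apply: (tensor_ext (f := tlift (fun a b => a ⊗ b)) (g := id)) => //.
  exact/tlift_is_linear/tens_bilin.
by move=> v w; rewrite tlift_tens //; exact: tens_bilin.
Qed.

Lemma sw_exchange (V W V' W' X : lmodType k) (F : V -> W -> V' -> W' -> X) s t :
  \sw_(a, b <- s) \sw_(c, d <- t) F a b c d =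
  \sw_(c, d <- t) \sw_(a, b <- s) F a b c d.
Proof.
rewrite /tlift; elim: (repr s) => [|v w|x IHx y IHy|x IHx|e x IHx] /=.
- by elim: (repr t) => [|v w|x IHx y IHy|x IHx|e x IHx] //=;
    rewrite -?IHx -?IHy ?addr0 ?oppr0 ?scaler0.
- by [].
- by rewrite IHx IHy -tlift_addf.
- rewrite IHx -scaleN1r -tlift_scalef; apply: eq_tlift => a b.
  by rewrite /= scaleN1r.
- by rewrite IHx -tlift_scalef.
Qed.

End SweedlerCalculus.

HB.mixin Record isCoalgebra (k : fieldType) C of GRing.Lmodule k C := {
  comul : C -> C ⊗ C;
  counit : C -> k;
  comul_linear : linear comul;
  counit_linear : scalar counit;
  comulA : forall c,
    \sw_(a, b <- comul c) \sw_(a1, a2 <- comul a) a1 ⊗ (a2 ⊗ b) =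
    \sw_(a, b <- comul c) \sw_(b1, b2 <- comul b) a ⊗ (b1 ⊗ b2);
  counitl : forall c, \sw_(a, b <- comul c) counit a *: b = c;
  counitr : forall c, \sw_(a, b <- comul c) counit b *: a = c
}.
#[short(type="coalgType")]
HB.structure Definition Coalgebra (k : fieldType) :=
  { C of GRing.Lmodule k C & isCoalgebra k C }.

HB.mixin Record isBialgebra (k : fieldType) H of
    GRing.Algebra k H & Coalgebra k H := {
  comul1 : comul (1 : H) = 1 :> H ⊗ H;
  comulM : forall a b : H, comul (a * b) = comul a * comul b :> H ⊗ H;
  counit1 : counit (1 : H) = 1 :> k;
  counitM : forall a b : H, counit (a * b) = counit a * counit b :> k
}.
#[short(type="bialgType")]
HB.structure Definition Bialgebra (k : fieldType) :=
  { H of GRing.Algebra k H & Coalgebra k H & isBialgebra k H }.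

HB.mixin Record isHopfAlgebra (k : fieldType) H of Bialgebra k H := {
  antipode : H -> H;
  antipode_linear : linear antipode;
  antipodel : forall a : H,
    \sw_(a1, a2 <- comul a) antipode a1 * a2 = counit a *: (1 : H);
  antipoder : forall a : H,
    \sw_(a1, a2 <- comul a) a1 * antipode a2 = counit a *: (1 : H)
}.
#[short(type="hopfAlgType")]
HB.structure Definition HopfAlgebra (k : fieldType) :=
  { H of Bialgebra k H & isHopfAlgebra k H }.

HB.instance Definition _ (k : fieldType) (C : coalgType k) :=
  GRing.isLinear.Build k C (C ⊗ C)%type *:%R (@comul k C) comul_linear.
HB.instance Definition _ (k : fieldType) (C : coalgType k) :=
  GRing.isLinear.Build k C k *%R (@counit k C) counit_linear.
HB.instance Definition _ (k : fieldType) (H : hopfAlgType k) :=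
  GRing.isLinear.Build k H H *:%R (@antipode k H) antipode_linear.

Section CoalgebraNotions.
Variables (k : fieldType) (C : coalgType k).
Local Open Scope classical_set_scope.

Definition cocommutative : Prop :=
  forall c : C, \sw_(a, b <- comul c) b ⊗ a = comul c.

Definition linear_subspace (V : lmodType k) (D : set V) : Prop :=
  D 0 /\ forall a x y, D x -> D y -> D (a *: x + y).

Definition subcoalgebra (D : set C) : Prop :=
  linear_subspace D /\
  comul @` D `<=` smallest (@linear_subspace (C ⊗ C)%type) [set a ⊗ b | a in D & b in D].

Definition simple_subcoalgebra (D : set C) : Prop :=
  [/\ subcoalgebra D, D <> [set 0] &
      forall E, subcoalgebra E -> E `<=` D -> E = [set 0] \/ E = D].

Definition coradical : set C :=
  smallest (@linear_subspace C) (\bigcup_(D in simple_subcoalgebra) D).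

(* The coradical (the sum of the simple subcoalgebras) is one-dimensional. *)
Definition coalg_connected : Prop :=
  exists2 g : C, g != 0 & coradical = [set a *: g | a in [set: k]].

End CoalgebraNotions.
Arguments cocommutative {k} C.
Arguments coalg_connected {k} C.
Arguments coradical {k} C.

Record coalgebra_hom (k : fieldType) (C D : coalgType k) (f : C -> D) : Prop := {
  coalgebra_hom_linear : linear f;
  coalgebra_hom_comul : forall c,
    comul (f c) = \sw_(c1, c2 <- comul c) f c1 ⊗ f c2;
  coalgebra_hom_counit : forall c, counit (f c) = counit c
}.

Record hopf_hom (k : fieldType) (H K : hopfAlgType k) (f : H -> K) : Prop := {
  hopf_hom_coalgebra : coalgebra_hom f;
  hopf_hom_1 : f 1 = 1;
  hopf_hom_mul : {morph f : a b / a * b};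
  hopf_hom_antipode : {morph f : a / antipode a}
}.

HB.mixin Record isLieAlgebra (k : fieldType) L of GRing.Lmodule k L := {
  lie : L -> L -> L;
  lie_bilinear : bilin lie;
  liexx : forall x, lie x x = 0;
  lie_jacobi : forall x y z,
    lie x (lie y z) + lie y (lie z x) + lie z (lie x y) = 0
}.
#[short(type="lieAlgType")]
HB.structure Definition LieAlgebra (k : fieldType) :=
  { L of GRing.Lmodule k L & isLieAlgebra k L }.

Section Primitives.
Variables (k : fieldType) (H : bialgType k).

Definition primitive : {pred H} := fun c => `[< comul c = c ⊗ 1 + 1 ⊗ c >].

Lemma primitiveP (c : H) : reflect (comul c = c ⊗ 1 + 1 ⊗ c) (c \in primitive).
Proof. exact: asboolP. Qed.

Let primitive_submod : submod_closed primitive.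
Proof.
split; first by apply/primitiveP; rewrite linear0 tens0 t0ens addr0.
move=> a x y /primitiveP px /primitiveP py; apply/primitiveP.
by rewrite linearP /= px py tensDl tensDr tensZl tensZr scalerDr addrACA.
Qed.
HB.instance Definition _ := GRing.isSubmodClosed.Build k H primitive primitive_submod.

Record prim : Type := Prim { prim_val : H; _ : prim_val \in primitive }.
HB.instance Definition _ := [isSub for prim_val].
HB.instance Definition _ := [Choice of prim by <:].
HB.instance Definition _ := [SubChoice_isSubLmodule of prim by <:].

Lemma prim_comul (x : prim) : comul (\val x) = \val x ⊗ 1 + 1 ⊗ \val x.
Proof. exact/primitiveP/valP. Qed.

Lemma counit_primitive (c : H) : c \in primitive -> counit c = 0.
Proof.
move=> /primitiveP pc; have b : bilin (fun a b : H => counit a *: b).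
  split=> u e v w /=; first by rewrite linearP scalerDl scalerA.
  by rewrite scalerDr !scalerA mulrC.
have := counitl c; rewrite pc tlift_pureD // counit1 scale1r.
move=> /(canRL (addrK _)); rewrite subrr => /(congr1 counit).
by rewrite linearZ /= counit1 mulr1 linear0.
Qed.

Lemma primitive_bracket (x y : H) :
  x \in primitive -> y \in primitive -> x * y - y * x \in primitive.
Proof.
move=> /primitiveP px /primitiveP py; apply/primitiveP.
rewrite linearB /= !comulM px py !(mulrDl, mulrDr) !tensM !(mulr1, mul1r).
rewrite -[in RHS]scaleN1r tensDl tensDr tensZl tensZr !scaleN1r !opprD !addrA.
rewrite [LHS](ACl ((1 * 5) * (4 * 8) * (2 * 7) * (3 * 6)))%AC /= !subrr !addr0.
by rewrite !addrA.
Qed.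

Let jacobi_terms (V : zmodType) (a b c d e f : V) :
  (a - b - (c - d)) + (c - e - (f - b)) + (f - d - (a - e)) = 0.
Proof.
rewrite !opprB !addrA.
rewrite [LHS](ACl ((1*12)*(7*2)*(3*10)*(5*4)*(11*6)*(9*8)))%AC /= !subrr.
by rewrite !addr0.
Qed.

Definition prim_lie (x y : prim) : prim :=
  Prim (primitive_bracket (valP x) (valP y)).

Let prim_lie_bilinear : bilin prim_lie.
Proof.
split=> u a v w; apply/val_inj => /=.
  by rewrite mulrDl mulrDr -scalerAl -scalerAr opprD addrACA scalerBr.
by rewrite mulrDl mulrDr -scalerAl -scalerAr opprD addrACA scalerBr.
Qed.

Let prim_liexx x : prim_lie x x = 0.
Proof. by apply/val_inj; rewrite /= subrr. Qed.

Let prim_lie_jacobi x y z :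
  prim_lie x (prim_lie y z) + prim_lie y (prim_lie z x) +
  prim_lie z (prim_lie x y) = 0.
Proof.
by apply/val_inj; rewrite /= !(mulrBl, mulrBr) !mulrA; exact: jacobi_terms.
Qed.

HB.instance Definition _ := isLieAlgebra.Build k prim
  prim_lie_bilinear prim_liexx prim_lie_jacobi.

End Primitives.
Arguments prim {k} H.

(* The universal enveloping algebra is the unital associative k-algebra
   presented by the generators x in L, the linear relations of L, and the
   relations [x, y] = x y - y x: terms modulo the least congruence containing
   the algebra axioms and these relations. *)
Section EnvelopingAlgebra.
Variables (k : fieldType) (L : lieAlgType k).

Inductive uterm : Type :=
| UZero | UOne | UGen of L | UAdd of uterm & uterm | UOpp of uterm
| UScale of k & uterm | UMul of uterm & uterm.

Inductive ueq : uterm -> uterm -> Prop :=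
| ueq_refl s : ueq s s
| ueq_sym s t : ueq s t -> ueq t s
| ueq_trans s t u : ueq s t -> ueq t u -> ueq s u
| ueq_add s s' t t' : ueq s s' -> ueq t t' -> ueq (UAdd s t) (UAdd s' t')
| ueq_opp s s' : ueq s s' -> ueq (UOpp s) (UOpp s')
| ueq_scale c s s' : ueq s s' -> ueq (UScale c s) (UScale c s')
| ueq_mul s s' t t' : ueq s s' -> ueq t t' -> ueq (UMul s t) (UMul s' t')
| ueq_addA s t u : ueq (UAdd s (UAdd t u)) (UAdd (UAdd s t) u)
| ueq_addC s t : ueq (UAdd s t) (UAdd t s)
| ueq_add0 s : ueq (UAdd UZero s) s
| ueq_addN s : ueq (UAdd (UOpp s) s) UZero
| ueq_scaleA a b s : ueq (UScale a (UScale b s)) (UScale (a * b) s)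
| ueq_scale1 s : ueq (UScale 1 s) s
| ueq_scaleDr a s t : ueq (UScale a (UAdd s t)) (UAdd (UScale a s) (UScale a t))
| ueq_scaleDl a b s : ueq (UScale (a + b) s) (UAdd (UScale a s) (UScale b s))
| ueq_mulA s t u : ueq (UMul s (UMul t u)) (UMul (UMul s t) u)
| ueq_mul1l s : ueq (UMul UOne s) s
| ueq_mul1r s : ueq (UMul s UOne) s
| ueq_mulDl s t u : ueq (UMul (UAdd s t) u) (UAdd (UMul s u) (UMul t u))
| ueq_mulDr s t u : ueq (UMul s (UAdd t u)) (UAdd (UMul s t) (UMul s u))
| ueq_scaleAl c s t : ueq (UScale c (UMul s t)) (UMul (UScale c s) t)
| ueq_scaleAr c s t : ueq (UScale c (UMul s t)) (UMul s (UScale c t))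
| ueq_genD x y : ueq (UGen (x + y)) (UAdd (UGen x) (UGen y))
| ueq_genZ c x : ueq (UGen (c *: x)) (UScale c (UGen x))
| ueq_gen_lie x y : ueq (UGen (lie x y))
    (UAdd (UMul (UGen x) (UGen y)) (UOpp (UMul (UGen y) (UGen x)))).

HB.instance Definition _ := gen_eqMixin uterm.
HB.instance Definition _ := gen_choiceMixin uterm.

Let ueqb s t := `[< ueq s t >].
Let ueqb_refl : reflexive ueqb.
Proof. by move=> s; apply/asboolP; exact: ueq_refl. Qed.
Let ueqb_sym : symmetric ueqb.
Proof. by move=> s t; apply/asboolP/asboolP; exact: ueq_sym. Qed.
Let ueqb_trans : transitive ueqb.
Proof.
by move=> t s u /asboolP st /asboolP tu; apply/asboolP; exact: ueq_trans st tu.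
Qed.
Definition ueq_equiv : equiv_rel uterm := EquivRel ueqb ueqb_refl ueqb_sym ueqb_trans.

Definition uea : Type := {eq_quot ueq_equiv}.
HB.instance Definition _ := Choice.on uea.

Definition upi (t : uterm) : uea := \pi_({eq_quot ueq_equiv}) t.
Definition urepr (x : uea) : uterm := repr (x : {eq_quot ueq_equiv}).

Lemma upiP s t : ueq s t -> upi s = upi t.
Proof. by move=> st; apply/eqmodP/asboolP. Qed.
Lemma upiE s t : upi s = upi t -> ueq s t.
Proof. by move=> /eqmodP/asboolP. Qed.
Lemma ureprK x : upi (urepr x) = x.
Proof. exact: reprK. Qed.
Lemma urepr_pi t : ueq (urepr (upi t)) t.
Proof. by apply: upiE; rewrite ureprK. Qed.

Definition uea_zero : uea := upi UZero.
Definition uea_one : uea := upi UOne.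
Definition uea_add (x y : uea) : uea := upi (UAdd (urepr x) (urepr y)).
Definition uea_opp (x : uea) : uea := upi (UOpp (urepr x)).
Definition uea_scale (c : k) (x : uea) : uea := upi (UScale c (urepr x)).
Definition uea_mul (x y : uea) : uea := upi (UMul (urepr x) (urepr y)).
Definition uea_in (x : L) : uea := upi (UGen x).

Let upiD s t : uea_add (upi s) (upi t) = upi (UAdd s t).
Proof. by apply: upiP; apply: ueq_add; exact: urepr_pi. Qed.
Let upiN s : uea_opp (upi s) = upi (UOpp s).
Proof. by apply: upiP; apply: ueq_opp; exact: urepr_pi. Qed.
Let upiZ c s : uea_scale c (upi s) = upi (UScale c s).
Proof. by apply: upiP; apply: ueq_scale; exact: urepr_pi. Qed.
Let upiM s t : uea_mul (upi s) (upi t) = upi (UMul s t).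
Proof. by apply: upiP; apply: ueq_mul; exact: urepr_pi. Qed.
Let upi_op := (upiD, upiN, upiZ, upiM).

Let uaddA : associative uea_add.
Proof.
move=> x y z; rewrite -(ureprK x) -(ureprK y) -(ureprK z) !upi_op.
exact/upiP/ueq_addA.
Qed.
Let uaddC : commutative uea_add.
Proof.
by move=> x y; rewrite -(ureprK x) -(ureprK y) !upi_op; exact/upiP/ueq_addC.
Qed.
Let uadd0 : left_id uea_zero uea_add.
Proof. by move=> x; rewrite -(ureprK x) !upi_op; exact/upiP/ueq_add0. Qed.
Let uaddN : left_inverse uea_zero uea_opp uea_add.
Proof. by move=> x; rewrite -(ureprK x) !upi_op; exact/upiP/ueq_addN. Qed.

HB.instance Definition _ := GRing.isZmodule.Build uea uaddA uaddC uadd0 uaddN.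

Let uscaleA a b x : uea_scale a (uea_scale b x) = uea_scale (a * b) x.
Proof. by rewrite -(ureprK x) !upi_op; exact/upiP/ueq_scaleA. Qed.
Let uscale1 : left_id 1 uea_scale.
Proof. by move=> x; rewrite -(ureprK x) !upi_op; exact/upiP/ueq_scale1. Qed.
Let uscaleDr : right_distributive uea_scale +%R.
Proof.
move=> a x y; rewrite -(ureprK x) -(ureprK y) -[+%R]/uea_add !upi_op.
exact/upiP/ueq_scaleDr.
Qed.
Let uscaleDl x : {morph uea_scale^~ x : a b / a + b}.
Proof.
move=> a b; rewrite -(ureprK x) -[+%R in RHS]/uea_add !upi_op.
exact/upiP/ueq_scaleDl.
Qed.

HB.instance Definition _ :=
  GRing.Zmodule_isLmodule.Build k uea uscaleA uscale1 uscaleDr uscaleDl.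

Definition lie_hom_to_alg (A : algType k) (f : L -> A) : Prop :=
  linear f /\ forall x y, f (lie x y) = f x * f y - f y * f x.

Section Lift.
Variable A : algType k.
Implicit Type f : L -> A.

Fixpoint ueval f (t : uterm) : A :=
  match t with
  | UZero => 0
  | UOne => 1
  | UGen x => f x
  | UAdd s t => ueval f s + ueval f t
  | UOpp s => - ueval f s
  | UScale c s => c *: ueval f s
  | UMul s t => ueval f s * ueval f t
  end.

(* For f as in lie_hom_to_alg, the algebra homomorphism extending f; for other
   f the value depends on chosen representatives. *)
Definition ulift f (x : uea) : A := ueval f (urepr x).

Let ueval_compat f : lie_hom_to_alg f ->
  forall s t, ueq s t -> ueval f s = ueval f t.
Proof.
move=> [fl fL] s t; elim=> //=; try by move=> *; congruence.
- by move=> *; rewrite addrA.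
- by move=> *; rewrite addrC.
- by move=> *; rewrite add0r.
- by move=> *; rewrite addNr.
- by move=> *; rewrite scalerA.
- by move=> *; rewrite scale1r.
- by move=> *; rewrite scalerDr.
- by move=> *; rewrite scalerDl.
- by move=> *; rewrite mulrA.
- by move=> *; rewrite mul1r.
- by move=> *; rewrite mulr1.
- by move=> *; rewrite mulrDl.
- by move=> *; rewrite mulrDr.
- by move=> *; rewrite scalerAl.
- by move=> *; rewrite scalerAr.
- by move=> x y; have := fl 1 x y; rewrite !scale1r.
- by move=> c x; exact: (scalable_linear fl).
Qed.

Lemma ulift_pi f : lie_hom_to_alg f -> forall t, ulift f (upi t) = ueval f t.
Proof. by move=> fh t; apply: ueval_compat => //; exact: urepr_pi. Qed.

Lemma ulift_in f x : lie_hom_to_alg f -> ulift f (uea_in x) = f x.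
Proof. by move=> fh; rewrite ulift_pi. Qed.

Lemma ulift_linear f : lie_hom_to_alg f -> linear (ulift f).
Proof.
move=> fh c x y; rewrite -(ureprK x) -(ureprK y) -[_ *: _]/(uea_scale _ _) upiZ.
by rewrite [X in ulift f X]upiD !(ulift_pi fh).
Qed.
End Lift.

Let one_neq0 : uea_one != 0.
Proof.
have z : @lie_hom_to_alg k^o (fun _ => 0).
  by split=> [c x y|x y] /=; rewrite ?(scaler0, mulr0, addr0, subrr).
apply/eqP => /(congr1 (ulift (fun _ => 0 : k^o))).
by rewrite !(ulift_pi z) /= => /eqP; rewrite oner_eq0.
Qed.
Let umulA : associative uea_mul.
Proof.
move=> x y z; rewrite -(ureprK x) -(ureprK y) -(ureprK z) !upi_op.
exact/upiP/ueq_mulA.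
Qed.
Let umul1l : left_id uea_one uea_mul.
Proof. by move=> x; rewrite -(ureprK x) upi_op; exact/upiP/ueq_mul1l. Qed.
Let umul1r : right_id uea_one uea_mul.
Proof. by move=> x; rewrite -(ureprK x) upi_op; exact/upiP/ueq_mul1r. Qed.
Let umulDl : left_distributive uea_mul +%R.
Proof.
move=> x y z; rewrite -(ureprK x) -(ureprK y) -(ureprK z) -[+%R]/uea_add !upi_op.
exact/upiP/ueq_mulDl.
Qed.
Let umulDr : right_distributive uea_mul +%R.
Proof.
move=> x y z; rewrite -(ureprK x) -(ureprK y) -(ureprK z) -[+%R]/uea_add !upi_op.
exact/upiP/ueq_mulDr.
Qed.

HB.instance Definition _ := GRing.Zmodule_isNzRing.Build uea
  umulA umul1l umul1r umulDl umulDr one_neq0.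

Let uscaleAl (c : k) (x y : uea) : c *: (x * y) = c *: x * y.
Proof.
rewrite -(ureprK x) -(ureprK y) -[*%R]/uea_mul -[*:%R]/uea_scale !upi_op.
exact/upiP/ueq_scaleAl.
Qed.
Let uscaleAr (c : k) (x y : uea) : c *: (x * y) = x * (c *: y).
Proof.
rewrite -(ureprK x) -(ureprK y) -[*%R]/uea_mul -[*:%R]/uea_scale !upi_op.
exact/upiP/ueq_scaleAr.
Qed.
HB.instance Definition _ := GRing.Lmodule_isLalgebra.Build k uea uscaleAl.
HB.instance Definition _ := GRing.Lalgebra_isAlgebra.Build k uea uscaleAr.

Lemma upi0 : upi UZero = 0. Proof. by []. Qed.
Lemma upi1 : upi UOne = 1. Proof. by []. Qed.
Lemma upi_add s t : upi (UAdd s t) = upi s + upi t.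
Proof. by rewrite -upiD. Qed.
Lemma upi_opp s : upi (UOpp s) = - upi s.
Proof. by rewrite -upiN. Qed.
Lemma upi_scale c s : upi (UScale c s) = c *: upi s.
Proof. by rewrite -upiZ. Qed.
Lemma upi_mul s t : upi (UMul s t) = upi s * upi t.
Proof. by rewrite -upiM. Qed.

Lemma uea_in_hom : lie_hom_to_alg uea_in.
Proof.
split=> [c x y|x y].
  rewrite -[_ *: uea_in _]upi_scale -upi_add; apply/upiP.
  apply: ueq_trans (ueq_genD _ _) _; apply: ueq_add; last exact: ueq_refl.
  exact: ueq_genZ.
by rewrite -!upi_mul -upi_opp -upi_add; exact/upiP/ueq_gen_lie.
Qed.

Lemma uea_ind (P : uea -> Prop) :
  P 1 -> (forall x, P (uea_in x)) ->
  (forall c u v, P u -> P v -> P (c *: u + v)) ->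
  (forall u v, P u -> P v -> P (u * v)) -> forall u, P u.
Proof.
move=> P1 Pg Pl PM u; rewrite -(ureprK u).
have P0 : P 0 by rewrite -(addNr 1) -scaleN1r; exact: Pl.
elim: (urepr u) => [||x|s IHs t IHt|s IHs|c s IHs|s IHs t IHt].
- exact: P0.
- exact: P1.
- exact: Pg.
- by rewrite upi_add -[upi s]scale1r; exact: Pl.
- by rewrite upi_opp -scaleN1r -[_ *: _]addr0; exact: Pl.
- by rewrite upi_scale -[_ *: _]addr0; exact: Pl.
- by rewrite upi_mul; exact: PM.
Qed.

Lemma ulift1 (A : algType k) (f : L -> A) : lie_hom_to_alg f -> ulift f 1 = 1.
Proof. by move=> fh; rewrite ulift_pi. Qed.

Lemma uliftM (A : algType k) (f : L -> A) : lie_hom_to_alg f ->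
  {morph ulift f : u v / u * v}.
Proof.
move=> fh u v; rewrite -(ureprK u) -(ureprK v) -upi_mul.
by rewrite !(ulift_pi fh).
Qed.

Lemma uea_ext (A : algType k) (f g : uea -> A) :
  linear f -> f 1 = 1 -> {morph f : u v / u * v} ->
  linear g -> g 1 = 1 -> {morph g : u v / u * v} ->
  (forall x, f (uea_in x) = g (uea_in x)) -> f =1 g.
Proof.
move=> fl f1 fM gl g1 gM fg; apply: uea_ind => [|x|c u v fu fv|u v fu fv].
- by rewrite f1 g1.
- exact: fg.
- by rewrite fl gl fu fv.
- by rewrite fM gM fu fv.
Qed.

End EnvelopingAlgebra.

Arguments uea_in {k L}.

Section SweedlerProducts.
Variables (k : fieldType) (A B : algType k).

Lemma swM2 (X : lmodType k) (G : A -> B -> X) (s t : A ⊗ B) : bilin G ->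
  \sw_(a, b <- s * t) G a b = \sw_(a, b <- s) \sw_(c, d <- t) G (a * c) (b * d).
Proof.
move=> bG; rewrite -[s * t]/(tmul s t) /tmul (sw_sw _ _ bG); apply: eq_tlift => a b.
rewrite (sw_sw _ _ bG); apply: eq_tlift => c d; exact: tlift_tens.
Qed.

Lemma swM (C : algType k) (G G1 G2 : A -> B -> C) (s t : A ⊗ B) :
  bilin G -> (forall a b c d, G (a * c) (b * d) = G1 a b * G2 c d) ->
  \sw_(a, b <- s * t) G a b =
  (\sw_(a, b <- s) G1 a b) * (\sw_(a, b <- t) G2 a b).
Proof.
move=> bG GM; rewrite swM2 //.
have rl (y : C) : linear (fun x => x * y).
  by move=> c u v; rewrite mulrDl scalerAl.
rewrite (linear_tlift _ _ (rl _)); apply: eq_tlift => a b.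
have ll (y : C) : linear (fun x => y * x).
  by move=> c u v; rewrite mulrDr scalerAr.
by rewrite (linear_tlift _ _ (ll _)); apply: eq_tlift => c d; rewrite GM.
Qed.

End SweedlerProducts.

(* The Hopf algebra structure of U(L), in which the elements of L are primitive. *)
Section EnvelopingHopf.
Variables (k : fieldType) (L : lieAlgType k).
Local Notation U := (uea L).
Local Notation j := (@uea_in k L).

Let jl : linear j. Proof. by case: (uea_in_hom L). Qed.
Let jlie x y : j (lie x y) = j x * j y - j y * j x.
Proof. by case: (uea_in_hom L) => _; apply. Qed.

Definition uea_comul : U -> U ⊗ U := ulift (fun x => j x ⊗ 1 + 1 ⊗ j x).
Definition uea_counit : U -> k := ulift (fun _ => 0 : k^o).

Let comul_hom : lie_hom_to_alg (fun x => j x ⊗ 1 + 1 ⊗ j x : U ⊗ U).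
Proof.
split=> [c x y|x y].
  by rewrite jl tensDl tensDr tensZl tensZr scalerDr addrACA.
rewrite jlie !(mulrDl, mulrDr) !tensM !(mulr1, mul1r).
rewrite -[in LHS]scaleN1r tensDl tensDr tensZl tensZr !scaleN1r !opprD !addrA.
rewrite [RHS](ACl ((1 * 5) * (4 * 8) * (2 * 7) * (3 * 6)))%AC /= !subrr !addr0.
by rewrite !addrA.
Qed.

Let counit_hom : @lie_hom_to_alg k L k^o (fun _ => 0).
Proof. by split=> [c x y|x y] /=; rewrite ?(scaler0, mulr0, addr0, subrr). Qed.

Let comulL : linear uea_comul. Proof. exact: ulift_linear. Qed.
Let counitL : scalar uea_counit. Proof. exact: (ulift_linear counit_hom). Qed.
Let comul_1 : uea_comul 1 = 1. Proof. exact: ulift1. Qed.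
Let comul_M u v : uea_comul (u * v) = uea_comul u * uea_comul v.
Proof. exact: uliftM. Qed.
Let counit_1 : uea_counit 1 = 1. Proof. exact: (ulift1 counit_hom). Qed.
Let counit_M u v : uea_counit (u * v) = uea_counit u * uea_counit v.
Proof. exact: (uliftM counit_hom). Qed.

Lemma uea_comul_in x : uea_comul (j x) = j x ⊗ 1 + 1 ⊗ j x.
Proof. exact: ulift_in. Qed.
Lemma uea_counit_in x : uea_counit (j x) = 0.
Proof. exact: (ulift_in _ counit_hom). Qed.

Fixpoint uanti_term (t : uterm L) : U :=
  match t with
  | UZero => 0
  | UOne => 1
  | UGen x => - j x
  | UAdd s t => uanti_term s + uanti_term t
  | UOpp s => - uanti_term s
  | UScale c s => c *: uanti_term s
  | UMul s t => uanti_term t * uanti_term s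
  end.

Definition uea_antipode (u : U) : U := uanti_term (urepr u).

Let uanti_compat s t : ueq s t -> uanti_term s = uanti_term t.
Proof.
elim=> //=; try by move=> *; congruence.
- by move=> *; rewrite addrA.
- by move=> *; rewrite addrC.
- by move=> *; rewrite add0r.
- by move=> *; rewrite addNr.
- by move=> *; rewrite scalerA.
- by move=> *; rewrite scale1r.
- by move=> *; rewrite scalerDr.
- by move=> *; rewrite scalerDl.
- by move=> *; rewrite mulrA.
- by move=> *; rewrite mulr1.
- by move=> *; rewrite mul1r.
- by move=> *; rewrite mulrDr.
- by move=> *; rewrite mulrDl.
- by move=> *; rewrite scalerAr.
- by move=> *; rewrite scalerAl.
- by move=> x y; have := jl 1 x y; rewrite !scale1r => ->; rewrite opprD.
- by move=> c x; have := scalable_linear jl c x => /= ->; rewrite scalerN.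
- by move=> x y; rewrite jlie !mulrNN opprB.
Qed.

Let uanti_pi t : uea_antipode (upi t) = uanti_term t.
Proof. by apply: uanti_compat; exact: urepr_pi. Qed.

Lemma uea_antipode_in x : uea_antipode (j x) = - j x.
Proof. exact: uanti_pi. Qed.
Let antipode_1 : uea_antipode 1 = 1. Proof. exact: uanti_pi. Qed.
Let antipode_M u v : uea_antipode (u * v) = uea_antipode v * uea_antipode u.
Proof. by rewrite -(ureprK u) -(ureprK v) -upi_mul !uanti_pi. Qed.
Let antipodeL : linear uea_antipode.
Proof.
move=> c u v; rewrite -(ureprK u) -(ureprK v) -upi_scale -upi_add.
by rewrite !uanti_pi.
Qed.

Let bilin_lmul (f g : U -> U) : linear f -> linear g ->
  bilin (fun a b => f a * g b).
Proof.
move=> fl gl; split=> u c v w /=; first by rewrite fl mulrDl scalerAl.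
by rewrite gl mulrDr scalerAr.
Qed.

Let idl : linear (@id U). Proof. by []. Qed.

Let counit_id_bilin : bilin (fun a b : U => uea_counit a *: b).
Proof.
split=> u c v w /=; first by rewrite counitL scalerDl scalerA.
by rewrite scalerDr !scalerA mulrC.
Qed.
Let id_counit_bilin : bilin (fun a b : U => uea_counit b *: a).
Proof.
split=> u c v w /=; first by rewrite scalerDr !scalerA mulrC.
by rewrite counitL scalerDl scalerA.
Qed.

Let uea_counitl u : \sw_(a, b <- uea_comul u) uea_counit a *: b = u.
Proof.
have bl := counit_id_bilin.
apply: (uea_ext (f := fun u => \sw_(a, b <- uea_comul u) uea_counit a *: b)
  (g := id)) => //= [c x y||x y|x].
- by rewrite comulL (tlift_is_linear bl).
- by rewrite comul_1 tlift_tens // counit_1 scale1r.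
- rewrite comul_M; apply: swM => // a b c d.
  by rewrite counit_M -scalerAl -scalerAr scalerA.
- by rewrite uea_comul_in tlift_pureD // uea_counit_in counit_1 scale0r scale1r add0r.
Qed.

Let uea_counitr u : \sw_(a, b <- uea_comul u) uea_counit b *: a = u.
Proof.
have bl := id_counit_bilin.
apply: (uea_ext (f := fun u => \sw_(a, b <- uea_comul u) uea_counit b *: a)
  (g := id)) => //= [c x y||x y|x].
- by rewrite comulL (tlift_is_linear bl).
- by rewrite comul_1 tlift_tens // counit_1 scale1r.
- rewrite comul_M; apply: swM => // a b c d.
  by rewrite counit_M -scalerAl -scalerAr scalerA.
- by rewrite uea_comul_in tlift_pureD // uea_counit_in counit_1 scale0r scale1r addr0.
Qed.

Let tens3_bilinl (b : U) : bilin (fun a1 a2 : U => a1 ⊗ (a2 ⊗ b)).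
Proof. by split=> u c v w /=; rewrite !(tensDl, tensDr, tensZl, tensZr). Qed.
Let tens3_bilinr (a : U) : bilin (fun b1 b2 : U => a ⊗ (b1 ⊗ b2)).
Proof. by split=> u c v w /=; rewrite !(tensDl, tensDr, tensZl, tensZr). Qed.

Let tens3l_bilin :
  bilin (fun a b : U => \sw_(a1, a2 <- uea_comul a) a1 ⊗ (a2 ⊗ b)).
Proof.
split=> u c v w /=; first by rewrite comulL (tlift_is_linear (tens3_bilinl _)).
rewrite -tlift_scalef -tlift_addf; apply: eq_tlift => x y.
by rewrite !(tensDr, tensZr).
Qed.
Let tens3r_bilin :
  bilin (fun a b : U => \sw_(b1, b2 <- uea_comul b) a ⊗ (b1 ⊗ b2)).
Proof.
split=> u c v w /=; last by rewrite comulL (tlift_is_linear (tens3_bilinr _)).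
rewrite -tlift_scalef -tlift_addf; apply: eq_tlift => x y.
by rewrite !(tensDl, tensZl).
Qed.

Let uea_comulA u :
  \sw_(a, b <- uea_comul u) \sw_(a1, a2 <- uea_comul a) a1 ⊗ (a2 ⊗ b) =
  \sw_(a, b <- uea_comul u) \sw_(b1, b2 <- uea_comul b) a ⊗ (b1 ⊗ b2).
Proof.
apply: (uea_ext
  (f := fun u => \sw_(a, b <- uea_comul u) \sw_(a1, a2 <- uea_comul a) a1 ⊗ (a2 ⊗ b))
  (g := fun u => \sw_(a, b <- uea_comul u) \sw_(b1, b2 <- uea_comul b) a ⊗ (b1 ⊗ b2)))
  => /= [c x y||x y|c x y||x y|x].
- by rewrite comulL (tlift_is_linear tens3l_bilin).
- by rewrite comul_1 tlift_tens // comul_1 tlift_tens.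
- rewrite comul_M; apply: swM => // a b c d; rewrite comul_M.
  by apply: swM => // a1 b1 c1 d1; rewrite !tensM.
- by rewrite comulL (tlift_is_linear tens3r_bilin).
- by rewrite comul_1 tlift_tens // comul_1 tlift_tens.
- rewrite comul_M; apply: swM => // a b c d; rewrite comul_M.
  by apply: swM => // a1 b1 c1 d1; rewrite !tensM.
- rewrite uea_comul_in !tlift_pureD // !uea_comul_in comul_1.
  by rewrite !tlift_pureD // !tlift_tens // !addrA.
Qed.

Let uea_antipodel u :
  \sw_(a, b <- uea_comul u) uea_antipode a * b = uea_counit u *: (1 : U).
Proof.
have bl := bilin_lmul antipodeL idl.
elim/uea_ind: u => [|x|c u v IHu IHv|u v IHu IHv].
- by rewrite comul_1 tlift_tens // antipode_1 mulr1 counit_1 scale1r.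
- rewrite uea_comul_in tlift_pureD // uea_antipode_in antipode_1 mulr1 mul1r.
  by rewrite addNr uea_counit_in scale0r.
- by rewrite comulL (tlift_is_linear bl) IHu IHv counitL scalerDl scalerA.
- rewrite comul_M swM2 // sw_exchange counit_M -scalerA -IHv -tlift_scalef.
  apply: eq_tlift => a b.
  have l : linear (fun x : U => uea_antipode a * x * b).
    by move=> c x y; rewrite mulrDr mulrDl -scalerAr -scalerAl.
  transitivity (uea_antipode a * (uea_counit u *: (1 : U)) * b); last first.
    by rewrite -scalerAr mulr1 -scalerAl.
  rewrite -IHu (linear_tlift _ _ l); apply: eq_tlift => c d.
  by rewrite antipode_M !mulrA.
Qed.

Let uea_antipoder u :
  \sw_(a, b <- uea_comul u) a * uea_antipode b = uea_counit u *: (1 : U).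
Proof.
have bl := bilin_lmul idl antipodeL.
elim/uea_ind: u => [|x|c u v IHu IHv|u v IHu IHv].
- by rewrite comul_1 tlift_tens // antipode_1 mulr1 counit_1 scale1r.
- rewrite uea_comul_in tlift_pureD // uea_antipode_in antipode_1 mulr1 mul1r.
  by rewrite subrr uea_counit_in scale0r.
- by rewrite comulL (tlift_is_linear bl) IHu IHv counitL scalerDl scalerA.
- rewrite comul_M swM2 // counit_M mulrC -scalerA -IHu -tlift_scalef.
  apply: eq_tlift => a b.
  have l : linear (fun x : U => a * x * uea_antipode b).
    by move=> c x y; rewrite mulrDr mulrDl -scalerAr -scalerAl.
  transitivity (a * (uea_counit v *: (1 : U)) * uea_antipode b); last first.
    by rewrite -scalerAr mulr1 -scalerAl.
  rewrite -IHv (linear_tlift _ _ l); apply: eq_tlift => c d.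
  by rewrite antipode_M !mulrA.
Qed.

HB.instance Definition _ := isCoalgebra.Build k (uea L)
  comulL counitL uea_comulA uea_counitl uea_counitr.
HB.instance Definition _ := isBialgebra.Build k (uea L)
  comul_1 comul_M counit_1 counit_M.
HB.instance Definition _ := isHopfAlgebra.Build k (uea L)
  antipodeL uea_antipodel uea_antipoder.

End EnvelopingHopf.

Section MilnorMoore.
Variables (k : fieldType) (H : hopfAlgType k).

Definition milnor_moore : uea (prim H) -> H := ulift (\val : prim H -> H).

Let val_hom : lie_hom_to_alg (\val : prim H -> H).
Proof. by split. Qed.

Lemma milnor_moore_in x : milnor_moore (uea_in x) = \val x.
Proof. exact: ulift_in. Qed.
Lemma milnor_moore_linear : linear milnor_moore.
Proof. exact: ulift_linear. Qed.
Lemma milnor_moore1 : milnor_moore 1 = 1.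
Proof. exact: ulift1. Qed.
Lemma milnor_mooreM : {morph milnor_moore : u v / u * v}.
Proof. exact: uliftM. Qed.
Lemma milnor_moore_unique (f : uea (prim H) -> H) :
  linear f -> f 1 = 1 -> {morph f : u v / u * v} ->
  (forall x, f (uea_in x) = \val x) -> f =1 milnor_moore.
Proof.
move=> fl f1 fM fi; apply: uea_ext => //; first exact: milnor_moore_linear.
- exact: milnor_moore1.
- exact: milnor_mooreM.
by move=> x; rewrite fi milnor_moore_in.
Qed.

End MilnorMoore.
Arguments milnor_moore {k} H.

Record module_bialgebra_action (k : fieldType) (H K : hopfAlgType k) := {
  mba_fun :> H -> K -> K;
  mba_bilinear : bilin mba_fun;
  mba_1l : forall x, mba_fun 1 x = x;
  mba_Ml : forall a b x, mba_fun (a * b) x = mba_fun a (mba_fun b x);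
  mba_1r : forall a, mba_fun a 1 = counit a *: 1;
  mba_Mr : forall a x y,
    mba_fun a (x * y) = \sw_(a1, a2 <- comul a) mba_fun a1 x * mba_fun a2 y;
  mba_counit : forall a x, counit (mba_fun a x) = counit a * counit x;
  mba_comul : forall a x, comul (mba_fun a x) =
    \sw_(a1, a2 <- comul a) \sw_(x1, x2 <- comul x)
      mba_fun a1 x1 ⊗ mba_fun a2 x2
}.

Record crossed_hom (k : fieldType) (H K : hopfAlgType k)
    (act : module_bialgebra_action H K) (pi : H -> K) : Prop := {
  crossed_hom_coalgebra : coalgebra_hom pi;
  crossed_hom_mul : forall a b,
    pi (a * b) = \sw_(a1, a2 <- comul a) pi a1 * act a2 (pi b)
}.

Record crossed_hom_morphism (k : fieldType) (H K H' K' : hopfAlgType k)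
    (act : module_bialgebra_action H K) (act' : module_bialgebra_action H' K')
    (pi : H -> K) (pi' : H' -> K') (f : K -> K') (g : H -> H') : Prop := {
  crossed_hom_morphism_f : hopf_hom f;
  crossed_hom_morphism_g : hopf_hom g;
  crossed_hom_morphism_pi : forall a, f (pi a) = pi' (g a);
  crossed_hom_morphism_act : forall a x, f (act a x) = act' (g a) (f x)
}.

Record crossed_hom_iso (k : fieldType) (H K H' K' : hopfAlgType k)
    (act : module_bialgebra_action H K) (act' : module_bialgebra_action H' K')
    (pi : H -> K) (pi' : H' -> K') (f : K -> K') (g : H -> H') : Prop := {
  crossed_hom_iso_morphism : crossed_hom_morphism act act' pi pi' f g;
  crossed_hom_iso_f : bijective f;
  crossed_hom_iso_g : bijective g
}.

Record lie_der_action (k : fieldType) (g h : lieAlgType k) := {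
  lda_fun :> g -> h -> h;
  lda_bilinear : bilin lda_fun;
  lda_lie : forall x y v,
    lda_fun (lie x y) v = lda_fun x (lda_fun y v) - lda_fun y (lda_fun x v);
  lda_der : forall x u v,
    lda_fun x (lie u v) = lie (lda_fun x u) v + lie u (lda_fun x v)
}.

Section Restrictions.
Variables (k : fieldType) (H K : hopfAlgType k).
Variable act : module_bialgebra_action H K.

Let actl x : linear (act^~ x). Proof. exact: ((mba_bilinear act).1 x). Qed.
Let actr a : linear (act a). Proof. exact: ((mba_bilinear act).2 a). Qed.
Let actDl a b x : act (a + b) x = act a x + act b x.
Proof. by have := actl x 1 a b; rewrite /= !scale1r. Qed.
Let actDr a x y : act a (x + y) = act a x + act a y.
Proof. by have := actr a 1 x y; rewrite /= !scale1r. Qed.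
Let actNl a x : act (- a) x = - act a x.
Proof. by have := scalable_linear (actl x) (-1) a; rewrite /= !scaleN1r. Qed.

Let act_tens_bilin (a1 a2 : H) : bilin (fun x1 x2 : K => act a1 x1 ⊗ act a2 x2).
Proof. exact/bilin_comp/actr/actr/tens_bilin. Qed.
Let act_tens_bilin2 (t : K ⊗ K) :
  bilin (fun a1 a2 : H => \sw_(x1, x2 <- t) act a1 x1 ⊗ act a2 x2).
Proof.
apply: (bilin_sw (F := fun a1 a2 x1 x2 => act a1 x1 ⊗ act a2 x2)) => c d.
by apply: (bilin_comp (f := act^~ c) (g := act^~ d)) => //; exact: tens_bilin.
Qed.
Let act_mul_bilin (x y : K) : bilin (fun a1 a2 : H => act a1 x * act a2 y).
Proof.
split=> u c v w /=; first by rewrite actl mulrDl scalerAl.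
by rewrite actl mulrDr scalerAr.
Qed.

Lemma act_primitive a x :
  a \in @primitive k H -> x \in @primitive k K -> act a x \in @primitive k K.
Proof.
move=> pa px; move/primitiveP: (pa) => ea; move/primitiveP: (px) => ex.
apply/primitiveP; rewrite mba_comul ea ex tlift_pureD // !tlift_pureD //.
rewrite !mba_1r !mba_1l counit1 (counit_primitive pa) !scale0r scale1r.
by rewrite tens0 t0ens addr0 add0r.
Qed.

Lemma act_primitiveM a (x y : K) : a \in @primitive k H ->
  act a (x * y) = act a x * y + x * act a y.
Proof. by move=> /primitiveP pa; rewrite mba_Mr pa tlift_pureD // !mba_1l. Qed.

Definition prim_act (a : prim H) (x : prim K) : prim K :=
  Prim (act_primitive (valP a) (valP x)).

Let prim_act_bilin : bilin prim_act.
Proof.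
split=> u c v w; apply/val_inj => /=; first exact: actl.
exact: actr.
Qed.

Let prim_act_lie x y v :
  prim_act (lie x y) v = prim_act x (prim_act y v) - prim_act y (prim_act x v).
Proof. by apply/val_inj; rewrite /= actDl actNl !mba_Ml. Qed.

Let prim_act_der x u v :
  prim_act x (lie u v) = lie (prim_act x u) v + lie u (prim_act x v).
Proof.
apply/val_inj; rewrite /= actDr -scaleN1r.
rewrite (scalable_linear (actr _)) /= scaleN1r.
rewrite !act_primitiveM ?(valP x) // [X in _ - X]addrC opprD addrACA.
by [].
Qed.

Definition prim_action : lie_der_action (prim H) (prim K) :=
  Build_lie_der_action prim_act_bilin prim_act_lie prim_act_der.

Variable pi : H -> K.
Hypothesis pi_crossed : crossed_hom act pi.

Lemma crossed_hom1 : pi 1 = 1.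
Proof.
have [[pl pD pe] pM] := pi_crossed.
have b : bilin (fun a1 a2 : H => pi a1 * act a2 (pi 1)).
  split=> u c v w /=; first by rewrite pl mulrDl scalerAl.
  by rewrite actl mulrDr scalerAr.
have bp : bilin (fun a b : H => pi a ⊗ pi b) by exact/bilin_comp/pl/pl/tens_bilin.
have pp : pi 1 = pi 1 * pi 1.
  by rewrite -[in LHS](mulr1 1) pM comul1 tlift_tens // mba_1l.
have Sp : antipode (pi 1) * pi 1 = 1.
  have := antipodel (pi 1); rewrite pD comul1 tlift_tens // tlift_tens.
    by rewrite pe counit1 scale1r.
  split=> u c v w /=; first by rewrite linearP mulrDl scalerAl.
  by rewrite mulrDr scalerAr.
by rewrite -[LHS]mul1r -{1}Sp -mulrA -pp.
Qed.

Lemma crossed_hom_primitive a :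
  a \in @primitive k H -> pi a \in @primitive k K.
Proof.
have [[pl pD pe] pM] := pi_crossed => /primitiveP pa; apply/primitiveP.
have bp : bilin (fun a b : H => pi a ⊗ pi b) by exact/bilin_comp/pl/pl/tens_bilin.
by rewrite pD pa tlift_pureD // crossed_hom1.
Qed.

Definition crossed_hom_restr (x : prim H) : prim K :=
  Prim (crossed_hom_primitive (valP x)).

Lemma crossed_hom_restr_linear : linear crossed_hom_restr.
Proof.
have [[pl _ _] _] := pi_crossed => c x y; apply/val_inj; exact: pl.
Qed.

End Restrictions.

(* The extension of a Lie algebra action of g on h by derivations to an action
   of U(g) on U(h): an element of g acts by the derivation of U(h) extending
   its action on h, and products in U(g) act by composition. *)
Section ExtendedAction.
Variables (k : fieldType) (g h : lieAlgType k) (rho : lie_der_action g h).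

Fixpoint uder_term (x : g) (t : uterm h) : uea h :=
  match t with
  | UZero | UOne => 0
  | UGen y => uea_in (rho x y)
  | UAdd s t => uder_term x s + uder_term x t
  | UOpp s => - uder_term x s
  | UScale c s => c *: uder_term x s
  | UMul s t => uder_term x s * upi t + upi s * uder_term x t
  end.

Definition uder (x : g) (v : uea h) : uea h := uder_term x (urepr v).

Fixpoint uact_term (t : uterm g) (v : uea h) : uea h :=
  match t with
  | UZero => 0
  | UOne => v
  | UGen x => uder x v
  | UAdd s t => uact_term s v + uact_term t v
  | UOpp s => - uact_term s v
  | UScale c s => c *: uact_term s v
  | UMul s t => uact_term s (uact_term t v)
  end.

Definition uact (u : uea g) (v : uea h) : uea h := uact_term (urepr u) v.

Let rhol y : linear (rho^~ y). Proof. exact: ((lda_bilinear rho).1 y). Qed.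
Let rhor x : linear (rho x). Proof. exact: ((lda_bilinear rho).2 x). Qed.
Let jl : linear (@uea_in k h). Proof. by case: (uea_in_hom h). Qed.
Let jD x y : @uea_in k h (x + y) = uea_in x + uea_in y.
Proof. by have := jl 1 x y; rewrite !scale1r. Qed.
Let jZ c x : @uea_in k h (c *: x) = c *: uea_in x.
Proof. exact: (scalable_linear jl). Qed.
Let jlie x y : @uea_in k h (lie x y) = uea_in x * uea_in y - uea_in y * uea_in x.
Proof. by case: (uea_in_hom h) => _; apply. Qed.

Let uder_compat x s t : ueq s t -> uder_term x s = uder_term x t.
Proof.
elim=> /=; try by move=> *; congruence.
- by move=> s1 s2 t1 t2 /upiP -> -> /upiP -> ->.
- by move=> *; rewrite addrA.
- by move=> *; rewrite addrC.
- by move=> *; rewrite add0r.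
- by move=> *; rewrite addNr.
- by move=> *; rewrite scalerA.
- by move=> *; rewrite scale1r.
- by move=> *; rewrite scalerDr.
- by move=> *; rewrite scalerDl.
- by move=> *; rewrite !upi_mul !(mulrDl, mulrDr) !mulrA addrA.
- by move=> *; rewrite upi1 mul0r add0r mul1r.
- by move=> *; rewrite upi1 mulr0 addr0 mulr1.
- by move=> *; rewrite upi_add !mulrDl addrACA.
- by move=> *; rewrite upi_add !mulrDr addrACA.
- by move=> *; rewrite upi_scale scalerDr !scalerAl.
- by move=> *; rewrite upi_scale scalerDr !scalerAr.
- by move=> y z; have := rhor x 1 y z; rewrite !scale1r => ->; rewrite jD.
- by move=> c y; have := scalable_linear (rhor x) c y => /= ->; rewrite jZ.
- move=> y z; rewrite lda_der jD !jlie /= -!/(uea_in _).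
  by rewrite opprD -!addrA; congr (_ + _); rewrite addrC addrA addrAC -addrA.
Qed.

Let uder_pi x t : uder x (upi t) = uder_term x t.
Proof. by apply: uder_compat; exact: urepr_pi. Qed.

Lemma uder_in x y : uder x (uea_in y) = uea_in (rho x y).
Proof. exact: uder_pi. Qed.
Lemma uder1 x : uder x 1 = 0.
Proof. exact: uder_pi. Qed.
Lemma uderM x u v : uder x (u * v) = uder x u * v + u * uder x v.
Proof. by rewrite -(ureprK u) -(ureprK v) -upi_mul !uder_pi. Qed.
Lemma uder_linear x : linear (uder x).
Proof.
move=> c u v; rewrite -(ureprK u) -(ureprK v) -upi_scale -upi_add.
by rewrite !uder_pi.
Qed.

Lemma uder_linearl v : linear (uder^~ v).
Proof.
move=> c x y /=; elim/uea_ind: v => [|z|d u v IHu IHv|u v IHu IHv].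
- by rewrite !uder1 scaler0 addr0.
- by rewrite !uder_in rhol jl.
- by rewrite !uder_linear IHu IHv !scalerDr !scalerA mulrC addrACA.
- rewrite !uderM IHu IHv mulrDl mulrDr -!scalerAl -!scalerAr scalerDr.
  by rewrite addrACA.
Qed.

Let uderD x u v : uder x (u + v) = uder x u + uder x v.
Proof. by have := uder_linear x 1 u v; rewrite !scale1r. Qed.

Lemma uder_lie x y v :
  uder (lie x y) v = uder x (uder y v) - uder y (uder x v).
Proof.
elim/uea_ind: v => [|z|d u v IHu IHv|u v IHu IHv].
- rewrite !uder1 -(scale0r (0 : uea h)).
  by rewrite !(scalable_linear (uder_linear _)) /= !scale0r subrr.
- by rewrite !uder_in lda_lie jD -scaleN1r jZ scaleN1r.
- by rewrite !uder_linear IHu IHv scalerBr opprD addrACA.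
- rewrite !uderM IHu IHv !uderD !uderM mulrBl mulrBr !opprD !addrA.
  rewrite [RHS](ACl ((1*5)*(4*8)*(2*7)*(3*6)))%AC /= !subrr !addr0.
  by rewrite !addrA.
Qed.

Let uact_term_linear t : linear (uact_term t).
Proof.
elim: t => [||x|s IHs t IHt|s IHs|d s IHs|s IHs t IHt] c u v //=.
- by rewrite scaler0 addr0.
- exact: uder_linear.
- by rewrite IHs IHt scalerDr addrACA.
- by rewrite IHs opprD scalerN.
- by rewrite IHs scalerDr !scalerA mulrC.
- by rewrite IHt IHs.
Qed.

Let uact_compat s t : ueq s t -> uact_term s =1 uact_term t.
Proof.
have fl x := uact_term_linear x.
elim=> //=; clear s t.
- by move=> s t _ IH v; rewrite IH.
- by move=> s t u _ IH _ IH' v; rewrite IH IH'.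
- by move=> s s' t t' _ IH _ IH' v; rewrite IH IH'.
- by move=> s s' _ IH v; rewrite IH.
- by move=> c s s' _ IH v; rewrite IH.
- by move=> s s' t t' _ IH _ IH' v; rewrite IH' IH.
- by move=> *; move=> v; rewrite addrA.
- by move=> *; move=> v; rewrite addrC.
- by move=> *; move=> v; rewrite add0r.
- by move=> *; move=> v; rewrite addNr.
- by move=> *; move=> v; rewrite scalerA.
- by move=> *; move=> v; rewrite scale1r.
- by move=> *; move=> v; rewrite scalerDr.
- by move=> *; move=> v; rewrite scalerDl.
- move=> s t u v; have := fl s 1 (uact_term t v) (uact_term u v).
  by rewrite !scale1r.
- by move=> c s t v; have := scalable_linear (fl s) c (uact_term t v) => /= ->.
- by move=> x y v; have := uder_linearl v 1 x y; rewrite /= !scale1r.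
- by move=> c x v; have := scalable_linear (uder_linearl v) c x.
- by move=> x y v; rewrite uder_lie.
Qed.

Let uact_pi t v : uact (upi t) v = uact_term t v.
Proof. by apply: uact_compat; exact: urepr_pi. Qed.

Lemma uact_in x : uact (uea_in x) =1 uder x.
Proof. by move=> v; rewrite uact_pi. Qed.
Lemma uact_1l v : uact 1 v = v.
Proof. exact: uact_pi. Qed.
Lemma uact_Ml u u' v : uact (u * u') v = uact u (uact u' v).
Proof. by rewrite -(ureprK u) -(ureprK u') -upi_mul !uact_pi. Qed.

Let uactl v : linear (uact^~ v).
Proof.
move=> c u u' /=; rewrite -(ureprK u) -(ureprK u') -upi_scale -upi_add.
by rewrite !uact_pi.
Qed.
Let uactr u : linear (uact u).
Proof. by rewrite -(ureprK u) => c v w; rewrite !uact_pi uact_term_linear. Qed.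

Let uact_bilin : bilin uact.
Proof. by split=> w c u v; [exact: uactl | exact: uactr]. Qed.

Let uact_1r u : uact u 1 = counit u *: 1.
Proof.
elim/uea_ind: u => [|x|c u v IHu IHv|u v IHu IHv].
- by rewrite uact_1l counit1 scale1r.
- by rewrite uact_in uder1 [counit _]uea_counit_in scale0r.
- by rewrite uactl IHu IHv linearP scalerDl scalerA.
- rewrite uact_Ml IHv (scalable_linear (uactr u)) /= IHu scalerA.
  by rewrite counitM mulrC.
Qed.

Let mul_bilin (x y : uea h) : bilin (fun a1 a2 => uact a1 x * uact a2 y).
Proof.
split=> u c v w /=; first by rewrite uactl mulrDl scalerAl.
by rewrite uactl mulrDr scalerAr.
Qed.

Let uact_Mr u x y :
  uact u (x * y) = \sw_(u1, u2 <- comul u) uact u1 x * uact u2 y.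
Proof.
elim/uea_ind: u x y => [|z|c u v IHu IHv|u v IHu IHv] x y.
- by rewrite comul1 tlift_tens // !uact_1l.
- rewrite [comul _]uea_comul_in tlift_pureD // !uact_1l !uact_in.
  exact: uderM.
- by rewrite uactl linearP (tlift_is_linear (mul_bilin x y)) IHu IHv.
- rewrite uact_Ml IHv (linear_tlift _ _ (uactr u)) comulM swM2 // sw_exchange.
  by apply: eq_tlift => a b; rewrite IHu; apply: eq_tlift => c d; rewrite !uact_Ml.
Qed.

Let uact_counit u v : counit (uact u v) = counit u * counit v.
Proof.
elim/uea_ind: u v => [|x|c u u' IHu IHv|u u' IHu IHv] v.
- by rewrite uact_1l counit1 mul1r.
- rewrite uact_in [counit (uea_in x)]uea_counit_in mul0r.
  elim/uea_ind: v => [|y|c u v IHu IHv|u v IHu IHv].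
  + by rewrite uder1 linear0.
  + by rewrite uder_in [LHS]uea_counit_in.
  + by rewrite uder_linear linearP /= IHu IHv mulr0 addr0.
  + by rewrite uderM linearD /= !counitM IHu IHv mulr0 mul0r addr0.
- by rewrite uactl !linearP /= IHu IHv mulrDl mulrA.
- by rewrite uact_Ml IHu IHv counitM mulrA.
Qed.

Let der2 (x : g) (t : uea h ⊗ uea h) : uea h ⊗ uea h :=
  \sw_(a, b <- t) (uder x a ⊗ b + a ⊗ uder x b).

Let der2_bilin x : bilin (fun a b : uea h => uder x a ⊗ b + a ⊗ uder x b).
Proof.
split=> u c v w /=.
  by rewrite uder_linear !tensDl !tensZl scalerDr addrACA.
by rewrite uder_linear !tensDr !tensZr scalerDr addrACA.
Qed.

Let der2D x s t : der2 x (s + t) = der2 x s + der2 x t.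
Proof. exact: tliftD. Qed.

Let der2M x s t : der2 x (s * t) = der2 x s * t + s * der2 x t.
Proof.
elim/tensor_ind: s => [a b|s s' IH IH']; last first.
  by rewrite mulrDl !der2D IH IH' !mulrDl addrACA.
elim/tensor_ind: t => [c d|t t' IH IH']; last first.
  by rewrite mulrDr !der2D IH IH' !mulrDr addrACA.
rewrite /der2 tensM !tlift_tens // !(mulrDl, mulrDr) !tensM !uderM.
rewrite tensDl tensDr.
by rewrite -!addrA; congr (_ + _); rewrite addrCA; congr (_ + _); rewrite addrC.
Qed.

Let act_tens_bilin (a1 a2 : uea g) :
  bilin (fun x1 x2 : uea h => uact a1 x1 ⊗ uact a2 x2).
Proof. exact/bilin_comp/uactr/uactr/tens_bilin. Qed.
Let act_tens_bilin2 (t : uea h ⊗ uea h) :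
  bilin (fun a1 a2 : uea g => \sw_(x1, x2 <- t) uact a1 x1 ⊗ uact a2 x2).
Proof.
apply: (bilin_sw (F := fun a1 a2 x1 x2 => uact a1 x1 ⊗ uact a2 x2)) => c d.
by apply: (bilin_comp (f := uact^~ c) (g := uact^~ d)) => //; exact: tens_bilin.
Qed.

Let uact_comul u v : comul (uact u v) =
  \sw_(u1, u2 <- comul u) \sw_(v1, v2 <- comul v) uact u1 v1 ⊗ uact u2 v2.
Proof.
elim/uea_ind: u v => [|x|c u u' IHu IHv|u u' IHu IHv] v.
- rewrite uact_1l comul1 tlift_tens //.
  by rewrite -[LHS]sw_id; apply: eq_tlift => a b; rewrite !uact_1l.
- rewrite uact_in [comul (uea_in x)]uea_comul_in tlift_pureD // -tlift_addf.
  transitivity (der2 x (comul v)); last first.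
    by apply: eq_tlift => a b; rewrite !uact_1l !uact_in.
  elim/uea_ind: v => [|y|c u v IHu IHv|u v IHu IHv].
  + by rewrite uder1 linear0 comul1 /der2 tlift_tens // uder1 tens0 t0ens addr0.
  + rewrite uder_in /der2 ![comul _]uea_comul_in tlift_pureD // !uder1 !uder_in.
    by rewrite tens0 t0ens addr0 add0r.
  + by rewrite uder_linear !linearP /= /der2 (tlift_is_linear (der2_bilin x)) IHu IHv.
  + by rewrite uderM linearD /= !comulM IHu IHv der2M.
- by rewrite uactl !linearP /= (tlift_is_linear (act_tens_bilin2 _)) IHu IHv.
- rewrite uact_Ml IHu comulM swM2 //; apply: eq_tlift => a b.
  rewrite IHv (sw_sw _ _ (act_tens_bilin _ _)); apply: eq_tlift => c d.
  rewrite (sw_sw _ _ (act_tens_bilin _ _)); apply: eq_tlift => e f.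
  by rewrite tlift_tens // !uact_Ml.
Qed.

Definition uea_action : module_bialgebra_action (uea g) (uea h) :=
  Build_module_bialgebra_action uact_bilin uact_1l uact_Ml uact_1r uact_Mr
    uact_counit uact_comul.

End ExtendedAction.

(* Main.v *)
From HB Require Import structures.
From mathcomp Require Import all_boot all_algebra.
From mathcomp Require Import boolp classical_sets.
Require Import Defs.

(** The theorem rests on the Milnor-Moore theorem: phi_H : U(P(H)) -> H and
phi_K are bijective. Once this is known, the relation phi_K pibar = pi phi_H
leaves pibar = phi_K^-1 pi phi_H as the only candidate. It is a composite of
coalgebra morphisms, and the crossed product rule for pi carries over to it
because phi intertwines the actions ([milnor_moore_uact]): primitive elements
act by derivations on both sides, so this can be checked on generators.

Both halves of the Milnor-Moore theorem come from one family of operators, the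
Adams operations Psi^m, the convolution powers of the identity of H.

Conilpotence. Connectedness only speaks of the coradical. In a cocommutative
coalgebra the subcoalgebras are the subspaces stable under the dual algebra
H^*, and the orbit of an element under H^* is finite-dimensional. A nonzero
orbit of minimal dimension is a simple subcoalgebra, so every nonzero orbit
contains 1. A functional f with f(1) = 0 kills 1 and therefore strictly lowers
the dimension of every nonzero orbit. This yields the induction principle
[conilpotent_ind], from which any linear map vanishing at 1 is locally nilpotent
for convolution.

Eulerian decomposition. As the identity is the convolution unit plus a locally
nilpotent map, Psi^m(x) is a polynomial in m, with coefficients e_i(x). All the
properties needed are read off by comparing coefficients, which characteristic 0
permits. Psi^(m+l) = Psi^m * Psi^l gives e_i = e_1^i / i! ([euler_expr]).
Cocommutativity makes Psi^m a coalgebra morphism, and the linear term in m of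
that property says that e_1(x) is primitive ([euler_primitive]). For x primitive,
Psi^m(x^n) = m^n x^n, so e_1 kills x^n unless n = 1 ([euler_primX]).

Surjectivity of phi. Every x equals Psi^1(x), the sum of the e_1^i(x) / i!, a
polynomial in primitive elements.

Injectivity of phi. U(L) is spanned by the powers of elements of L, by
polarization ([uea_powers_ind]). Regarding e_1 as a map G from H to U(P(H)),
the sum of the G^i / i! (convolution powers) sends phi(x^n) back to x^n for x
primitive, so it is a left inverse of phi. *)

Set Implicit Arguments.
Unset Strict Implicit.
Unset Printing Implicit Defensive.

Import GRing.Theory.
Local Open Scope ring_scope.

Local Notation bilin f := (bilinear_for *:%R *:%R f).

(** * Linear algebra without a finite-dimensional ambient space *)

Lemma linear_fun0 (k : fieldType) (V W : lmodType k) (h : V -> W) :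
  linear h -> h 0 = 0.
Proof. by move=> hl; rewrite -(scale0r 0) (scalable_linear hl) /= scale0r. Qed.

Section Subspaces.
Variables (k : fieldType) (V : lmodType k).
Implicit Types (S E D : V -> Prop) (s : seq V).

Lemma subspace0 S : linear_subspace S -> S 0. Proof. by case. Qed.

Lemma subspaceD S x y : linear_subspace S -> S x -> S y -> S (x + y).
Proof. by move=> [_ SP] Sx; rewrite -[x in x + y]scale1r; exact: SP. Qed.

Lemma subspaceZ S c x : linear_subspace S -> S x -> S (c *: x).
Proof. by move=> [S0 SP] Sx; rewrite -[_ *: _]addr0; exact: SP. Qed.

Lemma subspaceB S x y : linear_subspace S -> S x -> S y -> S (x - y).
Proof.
by move=> SP Sx Sy; rewrite -scaleN1r; apply: subspaceD => //; exact: subspaceZ.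
Qed.

Lemma subspace_sum S (I : Type) (r : seq I) (P : pred I) (F : I -> V) :
  linear_subspace S -> (forall i, P i -> S (F i)) -> S (\sum_(i <- r | P i) F i).
Proof.
move=> SP SF; apply: (big_ind S) => //; first exact: subspace0.
by move=> x y; exact: subspaceD.
Qed.

Lemma subspaceI S E : linear_subspace S -> linear_subspace E ->
  linear_subspace (fun x => S x /\ E x).
Proof.
move=> SP EP; split; first by split; exact: subspace0.
by move=> a x y [Sx Ex] [Sy Ey]; split; apply: subspaceD => //; exact: subspaceZ.
Qed.

Lemma subspace_preim (W : lmodType k) (h : W -> V) S :
  linear h -> linear_subspace S -> linear_subspace (fun w => S (h w)).
Proof.
move=> hl SP; split=> [|a x y Sx Sy].
  by rewrite (linear_fun0 hl); exact: subspace0.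
by rewrite hl; apply: subspaceD => //; exact: subspaceZ.
Qed.

Fixpoint span s (x : V) : Prop :=
  if s is v :: s' then exists c, span s' (x - c *: v) else x = 0.

Lemma span_subspace s : linear_subspace (span s).
Proof.
elim: s => [|v s [IH0 IH]]; split=> //=.
- by move=> a x y -> ->; rewrite scaler0 addr0.
- by exists 0; rewrite scale0r subr0.
- move=> a x y [c xc] [d yd]; exists (a * c + d).
  rewrite scalerDl -scalerA opprD addrACA -scalerBr; exact: IH.
Qed.

Lemma span_cons v s x : span s x -> span (v :: s) x.
Proof. by move=> sx; exists 0; rewrite scale0r subr0. Qed.

Lemma span_mem s v : v \in s -> span s v.
Proof.
elim: s => //= w s IH; rewrite inE => /orP[/eqP ->|/IH sv].
  by exists 1; rewrite scale1r subrr; exact: subspace0 (span_subspace s).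
exact: span_cons.
Qed.

Lemma span_sub s S : linear_subspace S -> {in s, forall v, S v} ->
  forall x, span s x -> S x.
Proof.
move=> SP; elim: s => [|v s IH] sS x /=; first by move=> ->; exact: subspace0.
move=> [c xc]; rewrite -(subrK (c *: v) x); apply: subspaceD => //.
  by apply: IH xc => u us; apply: sS; rewrite inE us orbT.
by apply: subspaceZ => //; apply: sS; rewrite inE eqxx.
Qed.

Lemma span_map (f : V -> V) s x : linear f -> span s x -> span (map f s) (f x).
Proof.
move=> fl sx; apply: (@span_sub s (fun x => span (map f s) (f x))) sx.
  exact: subspace_preim (span_subspace _).
by move=> v vs; apply: span_mem; exact: map_f.
Qed.

(** The dimension drop of rank-nullity: a linear relation between the spanning
vectors becomes, once h has killed its value w, a relation expressing one of
their images through the others. *)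
Lemma span_image_kernel (h : V -> V) s w : linear h -> h w = 0 -> w != 0 ->
  span s w -> exists2 t, (size t < size s)%N & forall x, span s x -> span t (h x).
Proof.
move=> hl hw wN0; elim: s w hw wN0 => [|v s IH] w hw wN0 /=.
  by move=> w0; rewrite w0 eqxx in wN0.
have hZ c x : h (c *: x) = c *: h x by exact: (scalable_linear hl).
move=> [c wc]; have [c0|cN0] := eqVneq c 0.
  rewrite c0 scale0r subr0 in wc; have [t lt_ts ht] := IH w hw wN0 wc.
  exists (h v :: t) => // x [a /ht xa]; exists a.
  by rewrite addrC -scaleNr hl scaleNr addrC in xa.
exists (map h s); first by rewrite size_map.
have hv : span (map h s) (h v).
  have -> : v = - c^-1 *: (w - c *: v) + c^-1 *: w.
    by rewrite scalerBr !scaleNr opprK scalerA mulVf // scale1r addrAC addNr add0r.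
  rewrite hl hZ hw scaler0 addr0; apply: subspaceZ; first exact: span_subspace.
  exact: span_map.
move=> x [a xa]; rewrite -(subrK (a *: v) x) addrC hl.
apply: subspaceD; [exact: span_subspace| |exact: span_map].
by apply: subspaceZ => //; exact: span_subspace.
Qed.

(** Dimension is counted by the length of spanning lists. If E is not contained
in the span of the tail s of v :: s, it has an element w with a nonzero
coefficient at v, and E is spanned by w and its intersection with span s. *)
Lemma subspace_of_span s E : linear_subspace E ->
  (forall x, E x -> span s x) ->
  exists t, [/\ forall x, E x <-> span t x, (size t <= size s)%N &
                size t = size s -> forall x, span s x -> E x].
Proof.
elim: s E => [|v s IH] E EP Es.
  exists [::]; split=> //= [x|_ x ->]; last exact: subspace0.
  by split=> [/Es|->] //; exact: subspace0.
have [Es'|/existsNP[w /not_implyP[Ew Nw]]] := pselect (forall x, E x -> span s x).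
  have [t [Et st tE]] := IH E EP Es'; exists t; split=> //=; first exact: leqW.
  by move=> e; rewrite e ltnn in st.
have [c wc] := Es w Ew.
have cN0 : c != 0 by apply: contra_notN Nw => /eqP c0; rewrite c0 scale0r subr0 in wc.
have vE : v = c^-1 *: w - c^-1 *: (w - c *: v).
  by rewrite scalerBr scalerA mulVf // scale1r opprB addrCA subrr addr0.
have [t [Et st tE]] := IH _ (subspaceI EP (span_subspace s)) (fun x => @proj2 _ _).
exists (w :: t); split=> //= [x|/succn_inj ets x [a xa]].
  split=> [Ex|[a xa]]; last first.
    rewrite -(subrK (a *: w) x); apply: subspaceD => //; last exact: subspaceZ.
    by case/Et: xa.
  have [a xa] := Es x Ex; exists (a / c); apply/Et; split.
    by apply: subspaceB => //; exact: subspaceZ.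
  have -> : x - (a / c) *: w = (x - a *: v) - (a / c) *: (w - c *: v).
    rewrite scalerBr scalerA divfK // opprB addrA subrK //.
  by apply: subspaceB => //; [exact: span_subspace|apply: subspaceZ => //; exact: span_subspace].
rewrite -(subrK (a *: v) x); apply: subspaceD => //; first by case: (tE ets _ xa).
apply: subspaceZ => //; rewrite vE; apply: subspaceB => //; first exact: subspaceZ.
by apply: subspaceZ => //; case: (tE ets _ wc).
Qed.

(** Induction on s, adding a vector v. If v is in span s, a form for s will do.
Otherwise some form h kills s and has value 1 at v, and if f is a form for the
projection a - h(a) v of a into the kernel of h, then f - f(v) h kills v. *)
Lemma form_off_span s a : ~ span s a ->
  exists f : V -> k, [/\ scalar f, {in s, forall v, f v = 0} & f a = 1].
Proof.
elim: s a => [|v s IH] a Na.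
  have /exists_linear_form[f fl fa] : a != 0 by apply/eqP; exact: Na.
  by exists f.
have [sv|/IH[h [hl hs hv]]] := pselect (span s v).
  have [|f [fl fs fa]] := IH a; first by apply: contra_not Na; exact: span_cons.
  exists f; split=> // u; rewrite inE => /orP[/eqP ->|/fs //].
  apply: (@span_sub s (fun x => f x = 0)) sv => //.
  split=> [|b x y fx fy]; last by rewrite fl fx fy mulr0 addr0.
  by have := fl (-1) 0 0; rewrite scaler0 addr0 mulN1r addNr.
have [|f [fl fs fa]] := IH (a - h a *: v); first by apply: contra_not Na => sa; exists (h a).
have fB x c y : f (x - c *: y) = f x - c * f y.
  by rewrite -scaleNr addrC fl mulNr addrC.
exists (fun x => f x - f v * h x); split=> [c x y|u|].
- by rewrite fl hl mulrDr mulrBr !mulrA (mulrC (f v)) opprD addrACA.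
- rewrite inE => /orP[/eqP ->|us]; first by rewrite hv mulr1 subrr.
  by rewrite fs // hs // mulr0 subrr.
- by rewrite -[RHS]fa fB mulrC.
Qed.

End Subspaces.

(** Polynomials with vector coefficients are determined by their values at the
integers, even modulo a subspace: in characteristic 0 the Vandermonde matrix of
the points 0, ..., n-1 is invertible. *)
Lemma subspace_coef (k : fieldType) (V : lmodType k) (S : V -> Prop) n
    (a : nat -> V) : [pchar k] =i pred0 -> linear_subspace S ->
  (forall m : nat, S (\sum_(i < n) m%:R ^+ i *: a i)) ->
  forall i, (i < n)%N -> S (a i).
Proof.
move=> char0 SP aS i ltin.
pose M := Vandermonde n (\row_(j < n) (j%:R : k)).
have Mu : M \in unitmx.
  rewrite unitmxE unitfE det_Vandermonde; apply/prodf_neq0 => p _.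
  apply/prodf_neq0 => q ltpq; rewrite !mxE -natrB ?(ltnW ltpq) //.
  by move/pcharf0P: char0 => ->; rewrite subn_eq0 -ltnNge.
have -> : a i = \sum_(j < n) (invmx M) j (Ordinal ltin) *:
                 \sum_(l < n) (j : nat)%:R ^+ l *: a l.
  transitivity (\sum_(l < n) (1%:M : 'M[k]_n) l (Ordinal ltin) *: a l).
    rewrite (bigD1 (Ordinal ltin)) //= mxE eqxx scale1r big1 ?addr0 // => l ne.
    by rewrite mxE (negPf ne) scale0r.
  under [RHS]eq_bigr do rewrite scaler_sumr.
  rewrite exchange_big /=; apply: eq_bigr => l _.
  rewrite -(mulmxV Mu) mxE scaler_suml; apply: eq_bigr => j _.
  by rewrite scalerA mulrC !mxE.
by apply: subspace_sum => // j _; exact: subspaceZ.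
Qed.

Lemma coef_inj (k : fieldType) (V : lmodType k) n (a b : nat -> V) :
  [pchar k] =i pred0 ->
  (forall m : nat, \sum_(i < n) m%:R ^+ i *: a i = \sum_(i < n) m%:R ^+ i *: b i) ->
  forall i, (i < n)%N -> a i = b i.
Proof.
move=> char0 ab i lti; apply/eqP; rewrite -subr_eq0; apply/eqP.
apply: (@subspace_coef k V (fun x => x = 0) n (fun i => a i - b i)) lti => //.
  by split=> // c x y -> ->; rewrite scaler0 addr0.
move=> m; under eq_bigr do rewrite scalerBr.
by rewrite sumrB ab subrr.
Qed.

Section TensorLegs.
Variables (k : fieldType) (V W : lmodType k).

Lemma bilin_form_scale (f : V -> k) : scalar f -> bilin (fun (a : V) (b : W) => f a *: b).
Proof.
move=> fl; split=> u c v w /=; first by rewrite fl scalerDl scalerA.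
by rewrite scalerDr !scalerA mulrC.
Qed.

Definition tsum (s : seq (V * W)) : V ⊗ W := \sum_(p <- s) (p.1 ⊗ p.2).

Lemma tensor_tsum t : exists s, t = tsum s.
Proof.
elim/tensor_ind: t => [v w|x y [s ->] [s' ->]].
  by exists [:: (v, w)]; rewrite /tsum big_seq1.
by exists (s ++ s'); rewrite /tsum big_cat.
Qed.

Lemma tlift_tsum (X : lmodType k) (F : V -> W -> X) s : bilin F ->
  tlift F (tsum s) = \sum_(p <- s) F p.1 p.2.
Proof.
move=> bF; rewrite /tsum; elim: s => [|p s IH].
  rewrite !big_nil -(scale0r 0) tliftZ // scale0r //.
by rewrite !big_cons tliftD // tlift_tens // IH.
Qed.

Let tens_absorb (s : seq (V * W)) a b : span (unzip1 s) a ->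
  exists s', unzip1 s' = unzip1 s /\ tsum s' = a ⊗ b + tsum s.
Proof.
rewrite /tsum; elim: s a => [a /= ->|[v w] s IH a /= [c /IH[s' [e1 e2]]]].
  by exists [::]; rewrite t0ens big_nil addr0.
exists ((v, w + c *: b) :: s'); rewrite /= e1; split=> //.
rewrite !big_cons /= e2 -[in RHS](subrK (c *: v) a) [in RHS]tensDl tensDr tensZr -tensZl.
by rewrite addrACA [X in X + _ = _]addrC addrACA.
Qed.

(** An expression with linearly independent first legs has, by the dual forms,
second legs of the form (f ⊗ id)(t). If some first leg depends on the
others it can be absorbed, without introducing any new first leg. *)
Lemma tensor_legs (P : V -> Prop) (Q : W -> Prop) s : linear_subspace Q ->
  {in s, forall p, P p.1} ->
  (forall f, scalar f -> Q (\sw_(a, b <- tsum s) f a *: b)) ->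
  exists s', [/\ tsum s' = tsum s, {in s', forall p, P p.1} &
                {in s', forall p, Q p.2}].
Proof.
move=> QP; have [n] := ubnP (size s); elim: n s => // n IH [|[a b] s] lts Ps Qs.
  by exists [::].
have Ps' : {in s, forall p, P p.1} by move=> p ps; apply: Ps; rewrite inE ps orbT.
have [sa|Nsa] := pselect (span (unzip1 s) a).
  have [s' [e1 e2]] := tens_absorb b sa.
  have es : tsum s' = tsum ((a, b) :: s) by rewrite e2 /tsum big_cons.
  have [|p ps||s'' [e'' P'' Q'']] := IH s'.
  - by rewrite -(size_map fst) -/(unzip1 s') e1 size_map.
  - have : p.1 \in unzip1 s by rewrite -e1; exact: map_f.
    by case/mapP => q qs ->; exact: Ps'.
  - by rewrite es.
  - by exists s''; split=> //; rewrite e'' es.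
have [f [fl fs fa]] := form_off_span Nsa.
have bE g : scalar g -> \sw_(u, v <- tsum ((a, b) :: s)) g u *: v =
    g a *: b + \sw_(u, v <- tsum s) g u *: v.
  by move=> gl; rewrite !(tlift_tsum _ (bilin_form_scale gl)) big_cons.
have Qb : Q b.
  have := Qs f fl; rewrite bE // fa scale1r (tlift_tsum _ (bilin_form_scale fl)).
  rewrite big_seq big1 ?addr0 // => p ps; rewrite fs ?scale0r //; exact: map_f.
have [//|//|g gl|s' [e' P' Q']] := IH s.
  have := subspaceB QP (Qs g gl) (subspaceZ (g a) QP Qb).
  by rewrite bE // addrAC subrr add0r.
exists ((a, b) :: s'); split.
- by rewrite /tsum !big_cons -!/(tsum _) e'.
- by move=> p; rewrite inE => /orP[/eqP ->|/P' //]; apply: Ps; rewrite inE eqxx.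
- by move=> p; rewrite inE => /orP[/eqP ->|/Q' //].
Qed.

End TensorLegs.

(** * Connected cocommutative coalgebras are conilpotent *)

Section CoalgebraFacts.
Variables (k : fieldType) (C : coalgType k).

(** Coassociativity in the form in which Sweedler sums use it. *)
Lemma sw_coassoc (X : lmodType k) (G : C -> C -> C -> X) c :
  (forall a, bilin (G a)) -> (forall b d, linear (fun a => G a b d)) ->
  \sw_(a, b <- comul c) \sw_(a1, a2 <- comul a) G a1 a2 b =
  \sw_(a, b <- comul c) \sw_(b1, b2 <- comul b) G a b1 b2.
Proof.
move=> G2 G1; pose F (a : C) (t : C ⊗ C) := tlift (G a) t.
have bF : bilin F.
  split=> u e v w /=; last by rewrite /F (tlift_is_linear (G2 _)).
  by rewrite /F -tlift_scalef -tlift_addf; apply: eq_tlift => b d; exact: G1.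
have := congr1 (tlift F) (comulA c).
have bl b : bilin (fun a1 a2 : C => a1 ⊗ (a2 ⊗ b)).
  by split=> u e v w /=; rewrite !(tensDl, tensDr, tensZl, tensZr).
rewrite !(sw_sw _ _ bF) => e; transitivity
    (\sw_(a, b <- comul c) tlift F (\sw_(a1, a2 <- comul a) a1 ⊗ (a2 ⊗ b))).
  apply: eq_tlift => a b; rewrite (sw_sw _ _ bF); apply: eq_tlift => a1 a2.
  by rewrite tlift_tens // /F tlift_tens.
rewrite e; apply: eq_tlift => a b; rewrite (sw_sw _ _ bF).
by apply: eq_tlift => b1 b2; rewrite tlift_tens // /F tlift_tens.
Qed.

Lemma sw_cocomm (X : lmodType k) (F : C -> C -> X) c : cocommutative C ->
  bilin F -> \sw_(a, b <- comul c) F a b = \sw_(a, b <- comul c) F b a.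
Proof.
move=> cC bF; rewrite -[in LHS]cC (sw_sw _ _ bF).
by apply: eq_tlift => a b; rewrite tlift_tens.
Qed.

(** The transpose of multiplication by f in the dual algebra. *)
Definition hit (f : C -> k) (x : C) : C := \sw_(a, b <- comul x) f a *: b.

Lemma hit_linear f : scalar f -> linear (hit f).
Proof.
by move=> fl c x y; rewrite /hit linearP (tlift_is_linear (bilin_form_scale _ fl)).
Qed.

Lemma hit_counit x : hit counit x = x. Proof. exact: counitl. Qed.

Lemma hitP (f g : C -> k) c x : hit (fun a => c * f a + g a) x = c *: hit f x + hit g x.
Proof.
rewrite /hit -tlift_scalef -tlift_addf; apply: eq_tlift => a b.
by rewrite scalerDl scalerA.
Qed.

Lemma hit_hit f g x : scalar f -> scalar g ->
  hit f (hit g x) = hit (fun a => \sw_(a1, a2 <- comul a) (g a1 * f a2 : k^o)) x.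
Proof.
move=> fl gl; rewrite /hit -/(hit f _) (linear_tlift _ _ (hit_linear fl)).
pose G (a b c : C) := (g a * f b) *: c.
have G2 a : bilin (G a).
  split=> u c v w; rewrite /G /=.
    by rewrite fl mulrDr scalerDl mulrCA scalerA.
  by rewrite scalerDr !scalerA mulrC.
have G1 b d : linear (fun a => G a b d).
  by move=> c u v; rewrite /G gl mulrDl scalerDl -mulrA scalerA.
transitivity (\sw_(a, b <- comul x) \sw_(a1, a2 <- comul a) G a1 a2 b).
  rewrite sw_coassoc //; apply: eq_tlift => a b.
  rewrite (scalable_linear (hit_linear fl)) /= /hit -tlift_scalef.
  by apply: eq_tlift => b1 b2; rewrite /G scalerA.
apply: eq_tlift => a b.
have sl : linear (fun c : k^o => (c : k) *: b).
  by move=> c u v; rewrite scalerDl scalerA.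
by rewrite (linear_tlift _ _ sl).
Qed.

Lemma conv_form_scalar (f g : C -> k) : scalar f -> scalar g ->
  scalar (fun a => \sw_(a1, a2 <- comul a) (g a1 * f a2 : k^o) : k).
Proof.
move=> fl gl c x y.
have b : bilin (fun a1 a2 => g a1 * f a2 : k^o).
  split=> u d v w /=; first by rewrite gl mulrDl -mulrA.
  by rewrite fl mulrDr mulrCA.
by rewrite linearP (tlift_is_linear b).
Qed.

Lemma hit_comm f g x : cocommutative C -> scalar f -> scalar g ->
  hit f (hit g x) = hit g (hit f x).
Proof.
move=> cC fl gl; rewrite !hit_hit //; congr (hit _ x); apply/funext => a.
have b : bilin (fun a1 a2 : C => g a1 * f a2 : k^o).
  split=> u d v w /=; first by rewrite gl mulrDl -mulrA.
  by rewrite fl mulrDr mulrCA.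
rewrite (sw_cocomm _ cC b); apply: (@eq_tlift _ _ _ k^o) => u v; exact: mulrC.
Qed.

Definition orbit (x y : C) : Prop := exists2 f, scalar f & y = hit f x.

Definition hit_stable (D : C -> Prop) :=
  forall f, scalar f -> forall x, D x -> D (hit f x).

Lemma orbit_refl x : orbit x x.
Proof.
by exists counit; [move=> c u v; rewrite linearP | rewrite hit_counit].
Qed.

Lemma orbit_subspace x : linear_subspace (orbit x).
Proof.
split=> [|c _ _ [f fl ->] [g gl ->]].
  exists (fun _ => 0) => [c u v|]; first by rewrite mulr0 addr0.
  have := hitP (fun _ => 0) (fun _ => 0) (-1) x.
  by rewrite scaleN1r addNr => <-; congr (hit _ x); apply/funext => a; rewrite mulr0 addr0.
exists (fun a => c * f a + g a); last by rewrite hitP.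
by move=> d u v; rewrite fl gl !mulrDr !mulrA (mulrC c) addrACA.
Qed.

Lemma orbit_stable x : hit_stable (orbit x).
Proof.
move=> f fl _ [g gl ->]; rewrite hit_hit //.
by exists (fun a => \sw_(a1, a2 <- comul a) (g a1 * f a2 : k^o)) => //; exact: conv_form_scalar.
Qed.

Lemma orbit_sub (D : C -> Prop) x : hit_stable D -> D x -> forall y, orbit x y -> D y.
Proof. by move=> Dst Dx y [f fl ->]; exact: Dst. Qed.

Lemma orbit_finite x : exists s, forall y, orbit x y -> span s y.
Proof.
have [s xs] := tensor_tsum (comul x); exists (unzip2 s) => _ [f fl ->].
rewrite /hit xs (tlift_tsum _ (bilin_form_scale _ fl)) big_seq.
apply: subspace_sum; first exact: span_subspace.
move=> p ps; apply: subspaceZ; first exact: span_subspace.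
exact/span_mem/map_f.
Qed.

(** Stability puts the second legs of the coproduct in D; by cocommutativity
they can be taken as first legs, and the argument applies once more. *)
Lemma stable_subcoalgebra D : cocommutative C -> linear_subspace D ->
  hit_stable D -> subcoalgebra D.
Proof.
move=> cC DP Dst; split=> // _ [x Dx <-] M [MP MD].
have [s xs] := tensor_tsum (comul x).
have [|f fl|s1 [e1 _ D1]] := @tensor_legs k C C (fun _ => True) D s DP; first by [].
  by rewrite -xs; exact: Dst.
pose s2 := [seq (p.2, p.1) | p <- s1].
have xs2 : comul x = tsum s2.
  rewrite -cC xs -e1 tlift_tsum /tsum ?big_map //.
  by split=> u c v w /=; rewrite (tensDl, tensDr) (tensZl, tensZr).
have [|f fl|s3 [e3 P3 D3]] := @tensor_legs k C C D D s2 DP.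
- by move=> _ /mapP[p ps ->]; exact: D1.
- by rewrite -xs2; exact: Dst.
rewrite xs2 -e3 /tsum big_seq; apply: subspace_sum => // p ps.
by apply: MD; exists p.1; [exact: P3|exists p.2 => //; exact: D3].
Qed.

Lemma subcoalgebra_stable D : subcoalgebra D -> hit_stable D.
Proof.
move=> [DP DD] f fl x Dx.
apply: (DD (comul x) _ (fun t => D (\sw_(a, b <- t) f a *: b))); first by exists x.
split; first exact: subspace_preim (tlift_is_linear (bilin_form_scale _ fl)) DP.
move=> _ [a Da [b Db <-]]; rewrite tlift_tens; first exact: subspaceZ.
exact: bilin_form_scale.
Qed.

(** Descent on the dimension of the orbit: an orbit of which no proper nonzero
subspace is a subcoalgebra is itself simple. *)
Lemma orbit_simple x : cocommutative C -> x != 0 ->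
  exists2 D, simple_subcoalgebra D & forall y, D y -> orbit x y.
Proof.
move=> cC; have [s xs] := orbit_finite x.
have [n] := ubnP (size s); elim: n x s xs => // n IH x s xs lts xN0.
have [t [xt st tx]] := subspace_of_span (orbit_subspace x) xs.
have [[E [[EP ED] [E0 [sub ne]]]]|nE] :=
  pselect (exists E, subcoalgebra E /\ (E <> set1 0 /\ (E `<=` orbit x /\ E <> orbit x))%classic).
  have [y Ey yN0] : exists2 y, E y & y != 0.
    apply: contrapT => nex; apply: E0; apply/funext => y; apply/propext; split.
      by move=> Ey; apply: contrapT => /eqP yN0; apply: nex; exists y.
    by move=> ->; exact: subspace0.
  have yE : forall z, orbit y z -> E z.
    by apply: orbit_sub => //; apply: subcoalgebra_stable.
  have [u [Eu su uE]] := subspace_of_span EP (fun z Ez => (xt z).1 (sub z Ez)).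
  have [z /yE Ez|||D DS yD] := IH y u.
  - exact/(Eu z).1.
  - apply: leq_trans (leq_trans _ st) lts; rewrite ltn_neqAle su andbT.
    apply/eqP => e; apply: ne; apply/funext => z; apply/propext; split.
      exact: sub.
    by move=> xz; apply: uE => //; apply/xt.
  - by [].
  - by exists D => // z /yD/yE/sub.
exists (orbit x) => //; split.
- apply: stable_subcoalgebra => //; [exact: orbit_subspace|exact: orbit_stable].
- by move=> x0; have := orbit_refl x; rewrite x0 => /eqP; rewrite (negPf xN0).
- move=> E ES Ex; apply: contrapT => /not_orP[E0 E1]; apply: nE.
  by exists E.
Qed.

End CoalgebraFacts.

Section Conilpotence.
Variables (k : fieldType) (H : bialgType k).
Hypotheses (H_connected : coalg_connected H) (H_cocomm : cocommutative H).

Lemma hit1 f : scalar f -> hit f (1 : H) = f 1 *: 1.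
Proof. by move=> fl; rewrite /hit comul1 tlift_tens //; exact: bilin_form_scale. Qed.

(** The generator g of the coradical lies in all nonzero orbits, in particular
in the orbit of 1, which is the line through 1. *)
Lemma unit_in_orbit x : x != 0 -> orbit x (1 : H).
Proof.
have [g gN0 cg] := H_connected.
have og y : y != 0 -> orbit y g.
  move=> /(orbit_simple H_cocomm)[D DS yD]; have [DC D0 _] := DS.
  have [d Dd dN0] : exists2 d, D d & d != 0.
    apply: contrapT => nex; apply: D0; apply/funext => d; apply/propext; split.
      by move=> Dd; apply: contrapT => /eqP dN0; apply: nex; exists d.
    by move=> ->; case: DC => DP _; exact: subspace0.
  have : coradical H d by move=> M [_ MD]; apply: MD; exists D.
  rewrite cg => -[c _ dE]; have cN0 : c != 0.
    by apply: contra_neq dN0 => c0; rewrite -dE c0 scale0r.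
  rewrite -[g]scale1r -(mulVf cN0) -scalerA dE.
  by apply: subspaceZ; [exact: orbit_subspace|exact: yD].
move=> /og xg; have [f fl gE] := og 1 (oner_neq0 H).
rewrite hit1 // in gE.
have fN0 : f 1 != 0 by apply: contra_neq gN0 => f0; rewrite gE f0 scale0r.
rewrite -[1]scale1r -(mulVf fN0) -scalerA -gE.
by apply: subspaceZ => //; exact: orbit_subspace.
Qed.

(** If f(1) = 0, the operator hit f kills 1, which lies in every nonzero orbit;
so it maps the finite-dimensional orbit of x onto a space of smaller dimension,
namely the orbit of hit f x. Induction on the dimension of the orbit therefore
gives Q for all hit f x with f(1) = 0, and these provide the second legs of
comul x - 1 ⊗ x. *)
Lemma conilpotent_ind (Q : H -> Prop) : linear_subspace Q ->
  (forall x s, comul x = 1 ⊗ x + tsum s -> {in s, forall p, Q p.2} -> Q x) ->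
  forall x, Q x.
Proof.
move=> QP Qstep x; have [s xs] := orbit_finite x.
have [n] := ubnP (size s); elim: n x s xs => // n IH x s xs lts.
have [->|xN0] := eqVneq x 0; first exact: subspace0.
have [t [xt st _]] := subspace_of_span (orbit_subspace x) xs.
have Qf f : scalar f -> f 1 = 0 -> Q (hit f x).
  move=> fl f1; have fL := hit_linear fl.
  have hf1 : hit f 1 = 0 by rewrite hit1 // f1 scale0r.
  have [u ltu uE] := span_image_kernel fL hf1 (oner_neq0 H) ((xt 1).1 (unit_in_orbit xN0)).
  apply: (IH _ u).
    move=> _ [g gl ->]; rewrite hit_comm //; apply: uE; apply/xt.
    by exists g.
  exact: leq_trans ltu (leq_trans st lts).
(* Contracting comul x - 1 ⊗ x with g is contracting comul x with
   g - g(1) counit, a form that vanishes at 1. *)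
have [s' xs'] := tensor_tsum (comul x - 1 ⊗ x).
have [|g gl|s2 [e2 _ Q2]] := @tensor_legs k H H (fun _ => True) Q s' QP.
- by [].
- pose f a := (- g 1) * counit a + g a.
  have fl : scalar f.
    by move=> c u v; rewrite /f linearP gl !mulrDr mulrCA addrACA.
  have -> : \sw_(a, b <- tsum s') g a *: b = hit f x.
    rewrite /f hitP hit_counit -xs'.
    rewrite -scaleN1r addrC (tlift_is_linear (bilin_form_scale _ gl)).
    by rewrite tlift_tens; [rewrite scaleN1r scaleNr|exact: bilin_form_scale].
  by apply: Qf => //; rewrite /f counit1 mulr1 addNr.
apply: (Qstep x s2) => //.
by rewrite e2 -xs' addrC subrK.
Qed.

End Conilpotence.

(** * The convolution ring Hom(C, A) *)

Section Convolution.
Variables (k : fieldType) (C : coalgType k) (A : algType k).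

Definition linear_pred : {pred C -> A} := fun f => `[< linear f >].

Lemma linear_predP f : reflect (linear f) (f \in linear_pred).
Proof. exact: asboolP. Qed.

(** Linear maps are packaged so that convolution becomes the product of a ring:
associativity, powers and the binomial formula are then those of rings. *)
Record chom : Type := CHom { chom_fun :> C -> A; _ : chom_fun \in linear_pred }.
HB.instance Definition _ := [isSub for chom_fun].
HB.instance Definition _ := gen_eqMixin chom.
HB.instance Definition _ := gen_choiceMixin chom.

Definition Chom (f : C -> A) (fl : linear f) : chom :=
  CHom (introT (linear_predP f) fl).

Lemma chom_linear (f : chom) : linear f.
Proof. exact/linear_predP/(valP f). Qed.

Lemma chomP (f g : chom) : f =1 g -> f = g.
Proof. by move=> fg; apply/val_inj/funext. Qed.

Lemma chomZ (f : chom) c x : f (c *: x) = c *: f x.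
Proof. exact: (scalable_linear (@chom_linear f)). Qed.

Let zero_lin : linear (fun _ : C => 0 : A).
Proof. by move=> c x y; rewrite scaler0 addr0. Qed.
Let add_lin (f g : chom) : linear (fun x => f x + g x).
Proof. by move=> c x y; rewrite !chom_linear scalerDr addrACA. Qed.
Let opp_lin (f : chom) : linear (fun x => - f x).
Proof. by move=> c x y; rewrite chom_linear opprD scalerN. Qed.

Let addA : associative (fun f g => Chom (add_lin f g)).
Proof. by move=> f g h; apply: chomP => x; exact: addrA. Qed.
Let addC : commutative (fun f g => Chom (add_lin f g)).
Proof. by move=> f g; apply: chomP => x; exact: addrC. Qed.
Let add0 : left_id (Chom zero_lin) (fun f g => Chom (add_lin f g)).
Proof. by move=> f; apply: chomP => x; exact: add0r. Qed.
Let addN : left_inverse (Chom zero_lin) (fun f => Chom (opp_lin f))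
  (fun f g => Chom (add_lin f g)).
Proof. by move=> f; apply: chomP => x; exact: addNr. Qed.

HB.instance Definition _ := GRing.isZmodule.Build chom addA addC add0 addN.

Lemma bilin_mul (f g : chom) : bilin (fun a b => f a * g b).
Proof.
split=> u c v w /=; first by rewrite chom_linear mulrDl scalerAl.
by rewrite chom_linear mulrDr scalerAr.
Qed.

Let mul_lin (f g : chom) : linear (fun x => \sw_(a, b <- comul x) f a * g b).
Proof. by move=> c x y; rewrite linearP (tlift_is_linear (bilin_mul f g)). Qed.
Let one_lin : linear (fun x : C => counit x *: (1 : A)).
Proof. by move=> c x y; rewrite linearP scalerDl scalerA. Qed.
Let mul (f g : chom) : chom := Chom (mul_lin f g).
Let one : chom := Chom one_lin.

Let mulL (y : A) : linear (fun x : A => y * x).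
Proof. by move=> c u v; rewrite mulrDr scalerAr. Qed.
Let mulR (y : A) : linear (fun x : A => x * y).
Proof. by move=> c u v; rewrite mulrDl scalerAl. Qed.

Let convA : associative mul.
Proof.
move=> f g h; apply: chomP => x /=.
transitivity (\sw_(a, b <- comul x) \sw_(b1, b2 <- comul b) f a * g b1 * h b2).
  apply: eq_tlift => a b; rewrite (linear_tlift _ _ (mulL _)).
  by apply: eq_tlift => b1 b2; rewrite mulrA.
rewrite -sw_coassoc; first last.
- by move=> b d c u v; rewrite chom_linear !mulrDl -!scalerAl.
- move=> a; split=> u c v w /=; rewrite chom_linear ?mulrDr ?mulrDl.
    by rewrite -scalerAr -scalerAl.
  by rewrite -scalerAr.
by apply: eq_tlift => a b; rewrite (linear_tlift _ _ (mulR _)).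
Qed.

Let conv1l : left_id one mul.
Proof.
move=> f; apply: chomP => x /=; rewrite -[in RHS](counitl x).
rewrite (linear_tlift _ _ (@chom_linear f)); apply: eq_tlift => a b.
by rewrite chomZ -scalerAl mul1r.
Qed.
Let conv1r : right_id one mul.
Proof.
move=> f; apply: chomP => x /=; rewrite -[in RHS](counitr x).
rewrite (linear_tlift _ _ (@chom_linear f)); apply: eq_tlift => a b.
by rewrite chomZ -scalerAr mulr1.
Qed.
Let convDl : left_distributive mul +%R.
Proof.
move=> f g h; apply: chomP => x /=; rewrite -[RHS]tlift_addf.
by apply: eq_tlift => a b; exact: mulrDl.
Qed.
Let convDr : right_distributive mul +%R.
Proof.
move=> f g h; apply: chomP => x /=; rewrite -[RHS]tlift_addf.
by apply: eq_tlift => a b; exact: mulrDr.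
Qed.

HB.instance Definition _ := GRing.Zmodule_isPzRing.Build chom
  convA conv1l conv1r convDl convDr.

Lemma convE (f g : chom) x : (f * g) x = \sw_(a, b <- comul x) f a * g b.
Proof. by []. Qed.
Lemma conv1E x : (1 : chom) x = counit x *: 1. Proof. by []. Qed.
Lemma chomDE (f g : chom) x : (f + g) x = f x + g x. Proof. by []. Qed.
Lemma chomBE (f g : chom) x : (f - g) x = f x - g x. Proof. by []. Qed.
Lemma chomMnE (f : chom) n x : (f *+ n) x = f x *+ n.
Proof. by elim: n => // n IH; rewrite !mulrS chomDE IH. Qed.
Lemma chom_sumE (I : Type) (r : seq I) (P : pred I) (F : I -> chom) x :
  (\sum_(i <- r | P i) F i) x = \sum_(i <- r | P i) F i x.
Proof. exact: (big_morph (fun f : chom => f x) (fun f g => chomDE f g x)). Qed.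

End Convolution.

Section Functoriality.
Variables (k : fieldType).

Lemma conv_post_mul (C : coalgType k) (A B : algType k) (h : A -> B)
    (hl : linear h) (hM : {morph h : x y / x * y}) (f g : chom C A) x :
  h ((f * g) x) = \sw_(a, b <- comul x) h (f a) * h (g b).
Proof. by rewrite convE (linear_tlift _ _ hl); apply: eq_tlift => a b; exact: hM. Qed.

Definition post (C : coalgType k) (A B : algType k) (h : A -> B)
    (hl : linear h) (f : chom C A) : chom C B.
Proof.
by apply: (@Chom k C B (h \o f)) => c x y /=; rewrite chom_linear hl.
Defined.

(** Post-composition with an algebra morphism is a morphism of convolution
rings. *)
Lemma postX (C : coalgType k) (A B : algType k) (h : A -> B)
    (hl : linear h) (h1 : h 1 = 1) (hM : {morph h : x y / x * y})
    (f : chom C A) n x : h ((f ^+ n) x) = (post hl f ^+ n) x.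
Proof.
elim: n x => [|n IH] x.
  by rewrite !expr0 !conv1E (scalable_linear hl) /= h1.
rewrite !exprS conv_post_mul // convE; apply: eq_tlift => a b.
by rewrite IH.
Qed.

End Functoriality.

(** * The Eulerian decomposition *)

Lemma sum_trunc (V : nmodType) (F : nat -> V) n m : (n <= m)%N ->
  (forall i, (n <= i)%N -> F i = 0) -> \sum_(i < m) F i = \sum_(i < n) F i.
Proof.
move=> le_nm F0; rewrite -!(big_mkord xpredT F) (big_cat_nat (n := n)) //=.
rewrite [X in _ + X]big_nat [X in _ + X]big1 ?addr0 // => i /andP[ni _].
exact: F0.
Qed.

Lemma linear_sumZ (k : fieldType) (V W : lmodType k) (h : V -> W) n
    (c : nat -> k) (a : nat -> V) : linear h ->
  h (\sum_(i < n) c i *: a i) = \sum_(i < n) c i *: h (a i).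
Proof.
move=> hl; elim: n => [|n IH].
  by rewrite !big_ord0 linear_fun0.
by rewrite !big_ord_recr /= addrC hl IH addrC.
Qed.

Section Binomials.
Variables (k : fieldType) (char0 : [pchar k] =i pred0).

Lemma natr_neq0 n : n.+1%:R != 0 :> k.
Proof. by move/pcharf0P: char0 => ->. Qed.

Lemma bin_polynomial i : exists p : {poly k}, forall m, p.[m%:R] = 'C(m, i)%:R.
Proof.
elim: i => [|i [p IH]]; first by exists 1 => m; rewrite bin0 hornerC.
exists (i.+1%:R^-1 *: (p * ('X - i%:R%:P))) => m.
rewrite hornerZ hornerM IH hornerXsubC.
apply: (mulfI (natr_neq0 i)); rewrite mulrA mulfV ?natr_neq0 // mul1r.
rewrite -natrM mul_bin_left natrM mulrC.
have [lemi|ltmi] := leqP i m; first by rewrite natrB.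
by rewrite bin_small // !mulr0.
Qed.

End Binomials.

Section ConvolutionPowers.
Variables (k : fieldType) (H : bialgType k).

Lemma comul_primX (x : H) n : x \in @primitive k H ->
  comul (x ^+ n) = \sum_(i < n.+1) (x ^+ (n - i) ⊗ x ^+ i) *+ 'C(n, i).
Proof.
move=> /primitiveP px.
have -> : comul (x ^+ n) = (x ⊗ 1 + 1 ⊗ x) ^+ n.
  by rewrite -px; elim: n => [|n IH]; rewrite ?expr0 ?comul1 // !exprS comulM IH.
rewrite exprDn_comm; last by rewrite /GRing.comm !tensM !mulr1 !mul1r.
apply: eq_bigr => i _; congr (_ *+ _).
have l j : (x ⊗ 1) ^+ j = x ^+ j ⊗ 1 :> H ⊗ H.
  by elim: j => [|j IH]; rewrite ?expr0 // !exprS IH tensM mulr1.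
have r j : (1 ⊗ x) ^+ j = 1 ⊗ x ^+ j :> H ⊗ H.
  by elim: j => [|j IH]; rewrite ?expr0 // !exprS IH tensM mulr1.
by rewrite l r tensM mulr1 mul1r.
Qed.

Lemma conv_primX (A : algType k) (f g : chom H A) x n : x \in @primitive k H ->
  (f * g) (x ^+ n) =
  \sum_(i < n.+1) (f (x ^+ (n - i)) * g (x ^+ i)) *+ 'C(n, i).
Proof.
move=> px; rewrite convE comul_primX //.
have bF := bilin_mul f g; have tl := tlift_is_linear bF.
transitivity (\sum_(i < n.+1) ('C(n, i)%:R *:
    (\sw_(a, b <- x ^+ (n - i) ⊗ x ^+ i) f a * g b))).
  rewrite -(linear_sumZ n.+1 (fun i => 'C(n, i)%:R) (fun i => x ^+ (n - i) ⊗ x ^+ i) tl).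
  by congr tlift; apply: eq_bigr => i _; rewrite scaler_nat.
by apply: eq_bigr => i _; rewrite tlift_tens // scaler_nat.
Qed.

(** The iterated coproduct distributes the p factors x among n copies of G, and
each copy needs exactly one of them; there are n! ways to do so when p = n. *)
Lemma conv_expr_primX (A : algType k) (G : chom H A) x (y : A) :
  x \in @primitive k H ->
  (forall i, G (x ^+ i) = if i == 1%N then y else 0) ->
  forall n p, (G ^+ n) (x ^+ p) = if p == n then y ^+ n *+ n`! else 0.
Proof.
move=> px Gx; have cx i : counit (x ^+ i.+1) = 0.
  by rewrite exprS counitM counit_primitive // mul0r.
elim=> [|n IH] p.
  rewrite expr0 conv1E; case: p => [|p]; last by rewrite cx scale0r.
  by rewrite expr0 counit1 scale1r.
rewrite exprSr conv_primX //; case: p => [|p].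
  by rewrite big_ord_recl big_ord0 Gx mulr0 mul0rn addr0.
rewrite big_ord_recl Gx mulr0 mul0rn add0r big_ord_recl big1 => [|i _]; last first.
  by rewrite Gx mulr0 mul0rn.
rewrite addr0 Gx /= /bump /= addn0 subn1 /= IH eqSS bin1.
case: eqP => [->|_]; last by rewrite mul0r mul0rn.
by rewrite mulrnAl -exprSr -mulrnA mulnC.
Qed.

End ConvolutionPowers.

Section Eulerian.
Variables (k : fieldType) (char0 : [pchar k] =i pred0) (H : bialgType k).
Hypotheses (H_connected : coalg_connected H) (H_cocomm : cocommutative H).

Lemma conv_locally_nilpotent (A : algType k) (f : chom H A) : f 1 = 0 ->
  forall x, exists N, forall n, (N <= n)%N -> (f ^+ n) x = 0.
Proof.
move=> f1; apply: (conilpotent_ind H_connected H_cocomm).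
  split; first by exists 0%N => n _; exact: linear_fun0 (@chom_linear _ _ _ _).
  move=> a x y [M xM] [N yN]; exists (maxn M N) => n; rewrite geq_max => /andP[Mn Nn].
  by rewrite chom_linear xM // yN // scaler0 addr0.
move=> x s xs Qs.
have [N sN] : exists N, forall n, (N <= n)%N -> {in s, forall p, (f ^+ n) p.2 = 0}.
  elim: s Qs {xs} => [|p s IH] Qs; first by exists 0%N.
  have [|N sN] := IH; first by move=> q qs; apply: Qs; rewrite inE qs orbT.
  have [|M pM] := Qs p; first by rewrite inE eqxx.
  exists (maxn M N) => n; rewrite geq_max => /andP[Mn Nn] q.
  by rewrite inE => /orP[/eqP -> | /sN ->] //; exact: pM.
exists N.+1 => -[//|n] leNn; rewrite exprS convE xs tliftD ?tlift_tens ?f1 ?mul0r ?add0r //.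
- rewrite tlift_tsum ?big_seq ?big1 // => [p ps|]; last exact: bilin_mul.
  by rewrite (sN n) ?mulr0.
all: exact: bilin_mul.
Qed.

Let id_linear : linear (@id H). Proof. by []. Qed.

Definition idC : chom H H := Chom id_linear.

(** With J the identity minus the convolution unit, the binomial formula writes
the m-th Adams operation as the sum of the C(m, i) J^i. At a given x the number
of nonzero terms is bounded independently of m, and C(m, i) is polynomial in
m. *)
Lemma adams_polynomial x : exists n (a : nat -> H),
  (forall m, (idC ^+ m) x = \sum_(i < n) m%:R ^+ i *: a i) /\
  forall i, (n <= i)%N -> a i = 0.
Proof.
pose J := idC - 1.
have J1 : J 1 = 0 by rewrite chomBE conv1E counit1 scale1r subrr.
have [N JN] := conv_locally_nilpotent J1 x.
have adamsE m : (idC ^+ m) x = \sum_(i < N) 'C(m, i)%:R *: (J ^+ i) x.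
  have -> : idC = 1 + J by rewrite addrC subrK.
  rewrite exprDn_comm; last exact/commr_sym/commr1.
  rewrite chom_sumE.
  transitivity (\sum_(i < maxn m.+1 N) 'C(m, i)%:R *: (J ^+ i) x).
    rewrite (@sum_trunc _ (fun i => 'C(m, i)%:R *: (J ^+ i) x) m.+1).
    - by apply: eq_bigr => i _; rewrite expr1n mul1r chomMnE scaler_nat.
    - exact: leq_maxl.
    - by move=> i ltmi; rewrite bin_small // scale0r.
  rewrite (@sum_trunc _ (fun i => 'C(m, i)%:R *: (J ^+ i) x) N) //.
    exact: leq_maxr.
  by move=> i /JN ->; rewrite scaler0.
pose p i := projT1 (cid (bin_polynomial char0 i)).
have pE i m : (p i).[m%:R] = 'C(m, i)%:R by exact: (projT2 (cid (bin_polynomial char0 i))).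
pose D := \max_(i < N) size (p i).
exists D, (fun j => \sum_(i < N) (p i)`_j *: (J ^+ i) x); split=> [m|j leDj].
  rewrite adamsE; under [RHS]eq_bigr do rewrite scaler_sumr.
  rewrite exchange_big /=; apply: eq_bigr => i _.
  rewrite -pE (@horner_coef_wide _ D) ?(leq_bigmax i) // scaler_suml.
  by apply: eq_bigr => j _; rewrite scalerA mulrC.
apply: big1 => i _; rewrite nth_default ?scale0r //.
exact: leq_trans (leq_bigmax i) leDj.
Qed.

Definition euler_bound x : nat := projT1 (cid (adams_polynomial x)).
Definition euler_fun i x : H := projT1 (cid (projT2 (cid (adams_polynomial x)))) i.

Arguments euler_fun : simpl never.

Lemma adamsE x n m : (euler_bound x <= n)%N ->
  (idC ^+ m) x = \sum_(i < n) m%:R ^+ i *: euler_fun i x.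
Proof.
have [aE a0] := projT2 (cid (projT2 (cid (adams_polynomial x)))) => le_n.
rewrite aE; apply/esym; apply: (@sum_trunc _ (fun i => m%:R ^+ i *: euler_fun i x)) => //.
by move=> i /a0 ai; rewrite [X in _ *: X]ai scaler0.
Qed.

Lemma euler_fun0 x i : (euler_bound x <= i)%N -> euler_fun i x = 0.
Proof. by have [_] := projT2 (cid (projT2 (cid (adams_polynomial x)))); apply. Qed.

Lemma euler_uniq x n (a : nat -> H) :
  (forall m, (idC ^+ m) x = \sum_(i < n) m%:R ^+ i *: a i) ->
  (forall i, (n <= i)%N -> a i = 0) -> forall i, euler_fun i x = a i.
Proof.
move=> aE a0 i.
pose N := maxn i.+1 (maxn n (euler_bound x)).
apply: (@coef_inj k H N (fun i => euler_fun i x)) => //; last exact: leq_maxl.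
move=> m; have [nN bN] : (n <= N)%N /\ (euler_bound x <= N)%N.
  by rewrite /N !leq_max !leqnn !orbT.
rewrite -adamsE // aE; apply/esym.
apply: (@sum_trunc _ (fun i => m%:R ^+ i *: a i)) => //.
by move=> j /a0 ->; rewrite scaler0.
Qed.

Let euler_linear i : linear (euler_fun i).
Proof.
move=> c x y; pose n := maxn i.+1 (maxn (euler_bound x) (euler_bound y)).
pose a j := if (j < n)%N then c *: euler_fun j x + euler_fun j y else 0.
have -> : c *: euler_fun i x + euler_fun i y = a i by rewrite /a leq_max leqnn.
apply: (@euler_uniq _ n) => [m|j]; last by rewrite /a ltnNge => ->.
rewrite chom_linear !(@adamsE _ n) ?leq_max ?leqnn ?orbT //.
rewrite scaler_sumr -big_split; apply: eq_bigr => j _ /=.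
by rewrite /a ltn_ord scalerDr !scalerA mulrC.
Qed.

(** The i-th coefficient of the Adams operations as polynomials in the exponent;
euler 1 is the convolution logarithm of the identity. *)
Definition euler i : chom H H := Chom (euler_linear i).

Lemma euler_sum x : exists N, forall n, (N <= n)%N -> x = \sum_(i < n) euler i x.
Proof.
exists (euler_bound x) => n le_n; rewrite -[LHS]/((idC ^+ 1) x) (@adamsE x n 1) //.
by apply: eq_bigr => i _; rewrite expr1n scale1r.
Qed.

Lemma euler0 : euler 0 = 1.
Proof.
apply: chomP => x; have := @adamsE x (euler_bound x).+1 0 (leqnSn _).
rewrite expr0 => ->; rewrite big_ord_recl expr0 scale1r big1 ?addr0 // => i _.
by rewrite exprS mul0r scale0r.
Qed.

(** The polynomial expansion at all legs of a tensor at once: the bound N is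
uniform because a tensor has finitely many legs. *)
Lemma sw_adams (X : lmodType k) (F : H -> H -> X) t : bilin F ->
  exists N, forall n m l, (N <= n)%N ->
  \sw_(a, b <- t) F ((idC ^+ m) a) ((idC ^+ l) b) =
  \sum_(i < n) m%:R ^+ i *: \sum_(j < n) l%:R ^+ j *:
    \sw_(a, b <- t) F (euler i a) (euler j b).
Proof.
move=> bF.
have b2 (f g : chom H H) : bilin (fun a b => F (f a) (g b)).
  by apply: bilin_comp => //; exact: chom_linear.
elim/tensor_ind: t => [v w|s t [M sM] [N tN]].
  exists (maxn (euler_bound v) (euler_bound w)) => n m l.
  rewrite geq_max => /andP[vn wn]; rewrite tlift_tens //.
  rewrite (adamsE m vn) (linear_sumZ n (fun i => m%:R ^+ i) _ (bF.1 _)).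
  apply: eq_bigr => i _; congr (_ *: _) => /=.
  rewrite (adamsE l wn) (linear_sumZ n (fun i => l%:R ^+ i) _ (bF.2 _)).
  by apply: eq_bigr => j _; rewrite tlift_tens //; exact: (b2 (euler i) (euler j)).
exists (maxn M N) => n m l; rewrite geq_max => /andP[Mn Nn].
rewrite tliftD // (sM n) // (tN n) // -big_split; apply: eq_bigr => i _ /=.
rewrite -scalerDr -big_split; congr (_ *: _); apply: eq_bigr => j _ /=.
by rewrite -scalerDr tliftD //; exact: (b2 (euler i) (euler j)).
Qed.

(** The additivity of Adams operations for convolution, differentiated in m at
m = 0. *)
Lemma euler_mul j : euler 1 * euler j = euler j.+1 *+ j.+1.
Proof.
apply: chomP => x; rewrite chomMnE.
have [N xN] := sw_adams (comul x) (bilin_mul idC idC).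
pose n := maxn N (maxn (euler_bound x) j.+2).
have [Nn xn jn] : [/\ (N <= n)%N, (euler_bound x <= n)%N & (j.+1 < n)%N].
  by rewrite /n !leq_max !leqnn !orbT.
apply: (@coef_inj k H n (fun j => (euler 1 * euler j) x)
  (fun j => euler j.+1 x *+ j.+1)) (ltnW jn) => // l.
(* Both sides are the coefficient of m in the expansion of the (m + l)-th power. *)
pose c i := \sum_(p < n) (l%:R ^+ (p - i) *+ 'C(p, i)) *: euler p x.
pose d i := \sum_(j < n) l%:R ^+ j *: (euler i * euler j) x.
transitivity (c 1%N); last first.
  pose F p := (l%:R ^+ p.-1 *+ p) *: euler p x.
  transitivity (\sum_(p < n) F p); first by apply: eq_bigr => p _; rewrite bin1 subn1.
  have F0 p : (n <= p)%N -> F p = 0.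
    by move=> np; rewrite /F [euler p x]euler_fun0 ?scaler0 // (leq_trans xn).
  rewrite -(sum_trunc (leqnSn n) F0) big_ord_recl /F mulr0n scale0r add0r.
  by apply: eq_bigr => i _; rewrite lift0 -scaler_nat scalerA mulr_natr.
have n1 : (1 < n)%N by exact: leq_trans jn.
apply/esym; apply: (@coef_inj k H n c d) n1 => // m.
rewrite -(xN _ m l Nn) -convE -exprD (adamsE _ xn).
under eq_bigr do rewrite scaler_sumr.
rewrite exchange_big; apply: eq_bigr => p _ /=.
rewrite natrD addrC exprDn scaler_suml.
pose F i := (m%:R ^+ i * (l%:R ^+ (p - i) *+ 'C(p, i))) *: euler p x.
transitivity (\sum_(i < p.+1) F i).
  rewrite -(@sum_trunc _ F p.+1 n) //; first by apply: eq_bigr => i _; rewrite scalerA.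
  by move=> i pi; rewrite /F bin_small // mulr0n mulr0 scale0r.
by apply: eq_bigr => i _; rewrite /F mulrnAr mulrC.
Qed.

Lemma euler_expr n : euler 1 ^+ n = euler n *+ n`!.
Proof.
elim: n => [|n IH]; first by rewrite expr0 euler0.
by rewrite exprS IH mulrnAr euler_mul -mulrnA factS.
Qed.

(** Cocommutativity makes the Adams operations coalgebra morphisms: the
coproduct is the product of the commuting elements a |-> a ⊗ 1 and
a |-> 1 ⊗ a of the convolution ring Hom(H, H ⊗ H). *)
Lemma comul_adams m x : comul ((idC ^+ m) x) =
  \sw_(a, b <- comul x) (idC ^+ m) a ⊗ (idC ^+ m) b.
Proof.
have ll : linear (fun a : H => a ⊗ (1 : H)) by move=> c u v; rewrite tensDl tensZl.
have rl : linear (fun a : H => (1 : H) ⊗ a) by move=> c u v; rewrite tensDr tensZr.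
have cE : post (@comul_linear k H) idC = post ll idC * post rl idC.
  apply: chomP => y; rewrite convE /= -[LHS]sw_id; apply: eq_tlift => a b.
  by rewrite tensM mulr1 mul1r.
have lr : GRing.comm (post ll idC) (post rl idC).
  apply: chomP => y; rewrite !convE /= -[in RHS](H_cocomm y).
  have b2 := bilin_mul (post rl idC) (post ll idC).
  rewrite (sw_sw _ _ b2); apply: eq_tlift => a b; rewrite tlift_tens //.
  by rewrite !tensM !mulr1 !mul1r.
rewrite (postX (@comul_linear k H)); [|exact: comul1|exact: comulM].
rewrite cE exprMn_comm // convE; apply: eq_tlift => a b.
rewrite -(postX ll) //; last by move=> u v; rewrite tensM mulr1.
rewrite -(postX rl) //; last by move=> u v; rewrite tensM mulr1.
by rewrite tensM mulr1 mul1r.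
Qed.

(** The linear term in m of [comul_adams]: on the right it collects the pairs of
indices (1, 0) and (0, 1), and euler 0 is the convolution unit. *)
Lemma euler_primitive x : euler 1 x \in @primitive k H.
Proof.
apply/primitiveP.
have ll : linear (fun a : H => euler 1 a ⊗ (1 : H)).
  by move=> c y z; rewrite chom_linear tensDl tensZl.
have rl : linear (fun a : H => (1 : H) ⊗ euler 1 a).
  by move=> c y z; rewrite chom_linear tensDr tensZr.
have [N xN] := sw_adams (comul x) (@tens_bilin k H H).
pose n := maxn N (euler_bound x).
have [Nn xn] : (N <= n.+2)%N /\ (euler_bound x <= n.+2)%N.
  by rewrite /n -!(addn2 (maxn _ _)) !(leq_trans _ (leq_addr _ _)) ?leq_max ?leqnn ?orbT.
pose w i j := \sw_(a, b <- comul x) euler i a ⊗ euler j b.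
pose d (p : 'I_n.+2 * 'I_n.+2) := (p.1 + p.2)%N.
have ltd p : (d p < n.+2 + n.+2)%N by rewrite /d -addSn leq_add // ltnW.
pose u l := \sum_(p | d p == l) w p.1 p.2.
have -> : euler 1 x ⊗ 1 + 1 ⊗ euler 1 x = u 1%N.
  rewrite /u (bigD1 (lift ord0 ord0, ord0)) //= (bigD1 (ord0, lift ord0 ord0)) //=.
  rewrite big1 => [|[[[|[|i]] ?] [[|[|j]] ?]]]; rewrite /d ?xpair_eqE -?val_eqE //=.
  rewrite addr0 -[RHS]/(w 1%N 0%N + w 0%N 1%N) /w euler0; congr (_ + _).
    rewrite -[in LHS](counitr x) (linear_tlift _ _ ll); apply: eq_tlift => a b.
    by rewrite chomZ conv1E tensZl tensZr.
  rewrite -[in LHS](counitl x) (linear_tlift _ _ rl); apply: eq_tlift => a b.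
  by rewrite chomZ conv1E tensZl tensZr.
(* The left-hand side has degree at most n + 1 in m; it is padded with zeros to
   the number of coefficients of the right-hand side. *)
pose v i := if (i < n.+2)%N then comul (euler i x) else 0.
have -> : comul (euler 1 x) = v 1%N by [].
have lt1 : (1 < n.+2 + n.+2)%N by [].
apply: (@coef_inj k (H ⊗ H)%type (n.+2 + n.+2) v u char0 _ 1%N lt1) => m.
transitivity (comul ((idC ^+ m) x)).
  rewrite (adamsE m xn) (linear_sumZ _ (fun i => m%:R ^+ i) (fun i => euler_fun i x) (@comul_linear k H)).
  pose F i := m%:R ^+ i *: (if (i < n.+2)%N then comul (euler i x) else 0).
  rewrite -[LHS]/(\sum_(i < n.+2 + n.+2) F i) (sum_trunc (leq_addr _ _)).
    by apply: eq_bigr => i _; rewrite /F ltn_ord.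
  by move=> i le_ni; rewrite /F ltnNge le_ni scaler0.
rewrite comul_adams (xN _ m m Nn).
under eq_bigr do rewrite scaler_sumr.
rewrite pair_bigA (partition_big (fun p => Ordinal (ltd p)) xpredT) //=.
apply: eq_bigr => l _; rewrite scaler_sumr; apply: eq_big => [p|p /eqP <-].
  by rewrite -val_eqE.
by rewrite scalerA -exprD.
Qed.

Lemma euler_primX x i n : x \in @primitive k H ->
  euler i (x ^+ n) = if i == n then x ^+ n else 0.
Proof.
move=> px; apply: (@euler_uniq (x ^+ n) n.+1 (fun i => if i == n then x ^+ n else 0)).
  move=> m; rewrite (bigD1 ord_max) //= eqxx big1 ?addr0 => [|j]; last first.
    by rewrite -val_eqE /= => /negPf ->; rewrite scaler0.
  elim: m n => [|m IH] p.
    rewrite expr0 conv1E; case: p => [|p]; first by rewrite !expr0 counit1.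
    by rewrite !exprS counitM counit_primitive // !mul0r !scale0r.
  rewrite exprSr conv_primX // -[m.+1]add1n natrD addrC exprDn scaler_suml.
  apply: eq_bigr => j _; rewrite IH -scalerAl -exprD subnK; last by rewrite -ltnS.
  by rewrite expr1n mulr1 -scalerMnl.
by move=> j ltnj; case: eqP ltnj => // ->; rewrite ltnn.
Qed.

End Eulerian.

(** * Enveloping algebras are spanned by powers of Lie elements *)

Section Polarization.
Variables (k : fieldType) (char0 : [pchar k] =i pred0) (A : algType k).

(** The sum is the linear coefficient in t of the power of x + t y. *)
Lemma subspace_polarize (S : A -> Prop) x y n : linear_subspace S ->
  (forall t : k, S ((x + t *: y) ^+ n.+1)) ->
  S (\sum_(i < n.+1) x ^+ i * y * x ^+ (n - i)).
Proof.
move=> SP Sxy; pose p : {poly A} := x%:P + y%:P * 'X.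
have p0 m : (p ^+ m)`_0 = x ^+ m.
  rewrite -!horner_coef0; elim: m => [|m IH]; first by rewrite !expr0 hornerC.
  rewrite !exprS -{}IH !horner_coef0 coef0M; congr (_ * _).
  by rewrite coefD coefC coefMX /= addr0.
have p1 m : (p ^+ m.+1)`_1 = \sum_(i < m.+1) x ^+ i * y * x ^+ (m - i).
  elim: m => [|m IH].
    rewrite expr1 big_ord_recl big_ord0 expr0 !mulr1 mul1r addr0.
    by rewrite coefD coefC coefMX coefC /= add0r.
  rewrite exprS coefM big_ord_recl big_ord_recl big_ord0 addr0 /= IH p0.
  rewrite [in RHS]big_ord_recl expr0 mul1r subn0 addrC /bump /= !coefD !coefC !coefMX !coefC.
  rewrite /= add0r addr0; congr (_ + _).
  by rewrite mulr_sumr; apply: eq_bigr => i _; rewrite /bump /= add1n subSS exprS !mulrA.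
rewrite -p1; set q := p ^+ n.+1.
apply: (@subspace_coef k A S (size q).+2 (fun i => q`_i)) => // m.
have -> : \sum_(i < (size q).+2) m%:R ^+ i *: q`_i = (x + m%:R *: y) ^+ n.+1; last by [].
have cA (r : {poly A}) : comm_poly r (m%:R%:A).
  by rewrite /comm_poly -scalerAl -scalerAr mul1r mulr1.
have <- : p.[m%:R%:A] = x + m%:R *: y.
  by rewrite hornerD hornerC hornerMX hornerC -scalerAr mulr1.
rewrite -horner_exp_comm // (horner_coef_wide _ (leqW (leqnSn (size q)))).
by apply: eq_bigr => i _; rewrite exprZn expr1n -scalerAr mulr1.
Qed.

End Polarization.

Section PowersSpan.
Variables (k : fieldType) (char0 : [pchar k] =i pred0) (L : lieAlgType k).
Local Notation j := (@uea_in k L).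

Let sandwich (S : uea L -> Prop) : linear_subspace S ->
  (forall x n, S (j x ^+ n)) ->
  forall n x y i, (i <= n)%N -> S (j x ^+ i * j y * j x ^+ (n - i)).
Proof.
move=> SP SX; have [jl jlie] := uea_in_hom L; elim=> [|n IH] x y.
  by move=> i; rewrite leqn0 => /eqP ->; rewrite subnn !expr0 mul1r mulr1 -[j y]expr1.
pose c i := j x ^+ i * j y * j x ^+ (n.+1 - i).
have cS i : (i <= n)%N -> S (c i.+1 - c i).
  move=> le_in; have := IH x (lie x y) i le_in.
  rewrite jlie mulrBr mulrBl /c subSS subSn // exprSr exprS !mulrA.
  by [].
have c0 i : (i <= n.+1)%N -> S (c i - c 0%N).
  elim: i => [|i IHi] le_in; first by rewrite subrr; exact: subspace0.
  rewrite -(subrK (c i) (c i.+1)) -addrA; apply: subspaceD => //; first exact: cS.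
  exact/IHi/ltnW.
have Sc0 : S (c 0%N).
  have : S (\sum_(i < n.+2) c i).
    apply: subspace_polarize => // t.
    by rewrite addrC -jl.
  have -> : \sum_(i < n.+2) c i = n.+2%:R *: c 0%N + \sum_(i < n.+2) (c i - c 0%N).
    by rewrite sumrB sumr_const card_ord scaler_nat addrC subrK.
  move=> Ssum.
  have S0 : S (\sum_(i < n.+2) (c i - c 0%N)).
    by apply: subspace_sum => // i _; apply: c0; rewrite -ltnS.
  have := subspaceB SP Ssum S0; rewrite addrK => /(subspaceZ n.+2%:R^-1 SP).
  by rewrite scalerA mulVf ?scale1r //; exact: natr_neq0.
move=> i lein; rewrite -/(c i) -(subrK (c 0%N) (c i)).
by apply: subspaceD => //; exact: c0.
Qed.

(** It suffices that left multiplication by a Lie element y preserves the span.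
Polarizing the power n+1 of x + t y, the sum of all x^i y x^(n-i) is in the
span; consecutive terms differ by x^i [x, y] x^(n-1-i), which lies there by
induction on n, so n+1 times y x^n does. *)
Lemma uea_powers_ind (S : uea L -> Prop) : linear_subspace S ->
  (forall x n, S (j x ^+ n)) -> forall u, S u.
Proof.
move=> SP SX u.
(* T is the span of the powers, as the intersection of all subspaces that
   contain them; it will be stable under multiplication, as S need not be. *)
pose T v := forall S' : uea L -> Prop, linear_subspace S' ->
  (forall x n, S' (j x ^+ n)) -> S' v.
have TP : linear_subspace T.
  split=> [S' S'P _|c v w Tv Tw S' S'P S'X]; first by case: S'P.
  by apply: subspaceD => //; [apply: subspaceZ => //; exact: Tv | exact: Tw].
have TX x n : T (j x ^+ n) by move=> S' _; apply.
have mulT : forall v w, T w -> T (v * w).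
  elim/uea_ind => [w|x w Tw|c v v' IHv IHv' w Tw|v v' IHv IHv' w Tw].
  - by rewrite mul1r.
  - apply: (Tw (fun w => T (j x * w))).
      apply: subspace_preim TP => c v v'.
      by rewrite mulrDr scalerAr.
    move=> y n; have := @sandwich T TP TX n y x 0%N (leq0n n).
    by rewrite expr0 mul1r subn0.
  - rewrite mulrDl -scalerAl.
    exact: subspaceD TP (subspaceZ c TP (IHv w Tw)) (IHv' w Tw).
  - by rewrite -mulrA; apply: (IHv (v' * w)); exact: IHv'.
have T1 : T 1 by rewrite -(expr0 (j 0)); exact: TX.
by have := mulT u 1 T1 S SP SX; rewrite mulr1.
Qed.

End PowersSpan.

(** * The Milnor-Moore isomorphism *)

Section HopfMorphisms.
Variables (k : fieldType) (H K : hopfAlgType k) (f : H -> K).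
Hypotheses (fC : coalgebra_hom f) (f1 : f 1 = 1) (fM : {morph f : a b / a * b}).

(** In the convolution ring Hom(H, K), both f S_H and S_K f are inverse to f. *)
Lemma bialgebra_hom_hopf : hopf_hom f.
Proof.
have [fl fD fe] := fC; split=> // a.
pose F : chom H K := Chom fl.
have Sl : linear (@antipode k H) by exact: antipode_linear.
have fSl : linear (fun x => f (antipode x)) by move=> c x y; rewrite Sl fl.
have Sfl : linear (fun x => antipode (f x)) by move=> c x y; rewrite fl antipode_linear.
pose fS : chom H K := Chom fSl; pose Sf : chom H K := Chom Sfl.
have fSF : fS * F = 1.
  apply: chomP => x; rewrite convE conv1E /=.
  have := congr1 f (antipodel x); rewrite (linear_tlift _ _ fl) (scalable_linear fl) /= f1.
  by move=> <-; apply: eq_tlift => u v; rewrite fM.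
have FSf : F * Sf = 1.
  apply: chomP => x; rewrite convE conv1E /= -fe -antipoder fD.
  have b : bilin (fun u v : K => u * antipode v).
    split=> u c v w /=; first by rewrite mulrDl scalerAl.
    by rewrite antipode_linear mulrDr scalerAr.
  by rewrite (sw_sw _ _ b); apply: eq_tlift => u v; rewrite tlift_tens.
have : fS = Sf by rewrite -[fS]mulr1 -FSf mulrA fSF mul1r.
by move=> /(congr1 (fun g : chom H K => g a)).
Qed.

End HopfMorphisms.

Section MilnorMooreHom.
Variables (k : fieldType) (H : hopfAlgType k).
Local Notation phi := (milnor_moore H).

Lemma milnor_moore_coalgebra_hom : coalgebra_hom phi.
Proof.
have pl := @milnor_moore_linear k H.
have bp : bilin (fun a b => phi a ⊗ phi b) by exact/bilin_comp/pl/pl/tens_bilin.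
split=> // [u|u].
  apply: (uea_ext (f := fun u => comul (phi u))
      (g := fun u => \sw_(a, b <- comul u) phi a ⊗ phi b)) => [c x y||x y|c x y||x y|x].
  - by rewrite pl linearP.
  - by rewrite milnor_moore1 comul1.
  - by rewrite milnor_mooreM comulM.
  - by rewrite linearP (tlift_is_linear bp).
  - by rewrite comul1 tlift_tens // milnor_moore1.
  - rewrite comulM; apply: swM => // a b c d.
    by rewrite !milnor_mooreM tensM.
  - rewrite milnor_moore_in prim_comul [comul (uea_in x)]uea_comul_in tlift_pureD //.
    by rewrite milnor_moore_in milnor_moore1.
elim/uea_ind: u => [|x|c u v IHu IHv|u v IHu IHv].
- by rewrite milnor_moore1 !counit1.
- by rewrite milnor_moore_in [RHS]uea_counit_in (counit_primitive (valP x)).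
- by rewrite pl !linearP /= IHu IHv.
- by rewrite milnor_mooreM !counitM IHu IHv.
Qed.

Lemma milnor_moore_hopf_hom : hopf_hom phi.
Proof.
apply: bialgebra_hom_hopf; first exact: milnor_moore_coalgebra_hom.
- exact: milnor_moore1.
- exact: milnor_mooreM.
Qed.

Lemma milnor_mooreX x n : phi (uea_in x ^+ n) = \val x ^+ n.
Proof.
elim: n => [|n IH]; first by rewrite !expr0 milnor_moore1.
by rewrite !exprS milnor_mooreM IH milnor_moore_in.
Qed.

End MilnorMooreHom.

Section MilnorMooreBijective.
Variables (k : fieldType) (char0 : [pchar k] =i pred0) (H : hopfAlgType k).
Hypotheses (H_connected : coalg_connected H) (H_cocomm : cocommutative H).
Local Notation phi := (milnor_moore H).
Local Notation e i := (euler char0 H_connected H_cocomm i).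

Lemma euler_divided_power i x : e i x = i`!%:R^-1 *: (e 1 ^+ i) x.
Proof.
rewrite euler_expr chomMnE -scaler_nat scalerA mulVf ?scale1r //.
by rewrite -(prednK (fact_gt0 i)) natr_neq0.
Qed.

Definition euler_prim x : prim H := Prim (euler_primitive char0 H_connected H_cocomm x).

(** Every x is the finite sum of the divided convolution powers of the
Eulerian idempotent, hence a polynomial in primitive elements. *)
Lemma milnor_moore_surj x : exists u, phi u = x.
Proof.
have pl := @milnor_moore_linear k H.
pose I y := exists u, phi u = y.
have IP : linear_subspace I.
  split; first by exists 0; exact: linear_fun0 pl.
  by move=> c _ _ [u <-] [v <-]; exists (c *: u + v); rewrite pl.
have Ie n : forall y, I ((e 1 ^+ n) y).
  elim: n => [|n IH] y.
    by rewrite expr0 conv1E; apply: subspaceZ => //; exists 1; rewrite milnor_moore1.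
  have [s ys] := tensor_tsum (comul y).
  rewrite exprS convE ys (tlift_tsum _ (bilin_mul _ _)); apply: subspace_sum => // p _.
  have [v vE] := IH p.2; exists (uea_in (euler_prim p.1) * v).
  by rewrite milnor_mooreM milnor_moore_in vE.
have [N xN] := euler_sum char0 H_connected H_cocomm x.
rewrite (xN N) //; apply: (subspace_sum _ IP) => i _.
by rewrite euler_divided_power; exact: subspaceZ.
Qed.

Let lift_linear : linear (fun x => uea_in (euler_prim x)).
Proof.
move=> c x y; have [jl _] := uea_in_hom (prim H); rewrite -jl; congr uea_in.
apply/val_inj; exact: (chom_linear (e 1)).
Qed.

Let G : chom H (uea (prim H)) := Chom lift_linear.

(** The convolution exponential of the Eulerian idempotent, taken in U(P(H))
instead of H, is a left inverse of the Milnor-Moore map; by linearity this is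
checked on powers of primitive elements. *)
Lemma milnor_moore_left_inverse u : exists N, forall n, (N <= n)%N ->
  \sum_(i < n) i`!%:R^-1 *: (G ^+ i) (phi u) = u.
Proof.
have pl := @milnor_moore_linear k H.
move: u; apply: (uea_powers_ind char0) => [|x p].
  split.
    exists 0%N => n _; apply: big1 => i _.
    by rewrite (linear_fun0 pl) (linear_fun0 (@chom_linear _ _ _ _)) scaler0.
  move=> c u v [M uM] [N vN]; exists (maxn M N) => n; rewrite geq_max => /andP[Mn Nn].
  rewrite -[in RHS](uM n Mn) -[in RHS](vN n Nn) scaler_sumr -big_split.
  apply: eq_bigr => i _ /=; rewrite pl chom_linear scalerDr !scalerA.
  by rewrite [X in X *: _ + _]mulrC.
have Gx i : G (\val x ^+ i) = if i == 1%N then uea_in x else 0.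
  rewrite /=; have := euler_primX char0 H_connected H_cocomm 1 i (valP x).
  case: (eqVneq i 1%N) => [-> | _] ex.
    by congr uea_in; apply/val_inj; rewrite -[RHS]expr1.
  have [jl _] := uea_in_hom (prim H).
  have -> : euler_prim (\val x ^+ i) = 0 by exact/val_inj.
  exact: linear_fun0 jl.
exists p.+1 => n ltpn; rewrite milnor_mooreX (bigD1 (Ordinal ltpn)) //= big1 => [|i].
  rewrite addr0 (conv_expr_primX (valP x) Gx) eqxx -scaler_nat scalerA mulVf ?scale1r //.
  by rewrite -(prednK (fact_gt0 p)) natr_neq0.
rewrite -val_eqE /= => iNp.
by rewrite (conv_expr_primX (valP x) Gx) eq_sym (negPf iNp) scaler0.
Qed.

Lemma milnor_moore_bijective : bijective phi.
Proof.
have inj : injective phi.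
  move=> u v uv; have [M uM] := milnor_moore_left_inverse u.
  have [N vN] := milnor_moore_left_inverse v.
  by rewrite -(uM (maxn M N)) ?leq_maxl // uv vN ?leq_maxr.
pose psi x := projT1 (cid (milnor_moore_surj x)).
have psiK : cancel psi phi by move=> x; exact: projT2 (cid (milnor_moore_surj x)).
by exists psi => // u; apply: inj; rewrite psiK.
Qed.

End MilnorMooreBijective.

(** * Transport of the crossed homomorphism *)

Section Transport.
Variables (k : fieldType) (H K : hopfAlgType k) (act : module_bialgebra_action H K).

Let actl x : linear (act^~ x). Proof. exact: ((mba_bilinear act).1 x). Qed.
Let actr a : linear (act a). Proof. exact: ((mba_bilinear act).2 a). Qed.

Lemma milnor_moore_uder x v :
  milnor_moore K (uder (prim_action act) x v) = act (\val x) (milnor_moore K v).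
Proof.
have pl := @milnor_moore_linear k K.
elim/uea_ind: v => [|y|c u v IHu IHv|u v IHu IHv].
- rewrite uder1 milnor_moore1 mba_1r (counit_primitive (valP x)) scale0r.
  exact: linear_fun0 pl.
- by rewrite uder_in !milnor_moore_in.
- by rewrite uder_linear !pl IHu IHv actr.
- have := pl 1 (uder (prim_action act) x u * v) (u * uder (prim_action act) x v).
  rewrite !scale1r uderM => ->; rewrite !milnor_mooreM IHu IHv.
  by rewrite (act_primitiveM _ _ _ (valP x)).
Qed.

Lemma milnor_moore_uact u v :
  milnor_moore K (uea_action (prim_action act) u v) =
  act (milnor_moore H u) (milnor_moore K v).
Proof.
have pl := @milnor_moore_linear k.
elim/uea_ind: u v => [|x|c u u' IHu IHu'|u u' IHu IHu'] v /=.
- by rewrite uact_1l milnor_moore1 mba_1l.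
- by rewrite uact_in milnor_moore_uder milnor_moore_in.
- have al : linear ((uact (prim_action act))^~ v).
    exact: (mba_bilinear (uea_action (prim_action act))).1 v.
  rewrite al !pl actl.
  by rewrite IHu IHu'.
- by rewrite uact_Ml IHu IHu' milnor_mooreM mba_Ml.
Qed.

End Transport.

Lemma coalgebra_hom_comp (k : fieldType) (A B C : coalgType k) (f : B -> C) (g : A -> B) :
  coalgebra_hom f -> coalgebra_hom g -> coalgebra_hom (f \o g).
Proof.
move=> [fl fD fe] [gl gD ge]; split=> [c x y|c|c] /=.
- by rewrite gl fl.
- have bf : bilin (fun a b => f a ⊗ f b) by exact/bilin_comp/fl/fl/tens_bilin.
  rewrite fD gD (sw_sw _ _ bf); apply: eq_tlift => a b.
  by rewrite tlift_tens.
- by rewrite fe ge.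
Qed.

Lemma coalgebra_hom_inv (k : fieldType) (C D : coalgType k) (f : C -> D) (g : D -> C) :
  coalgebra_hom f -> cancel f g -> cancel g f -> coalgebra_hom g.
Proof.
move=> [fl fD fe] fK gK.
have gl : linear g by move=> c x y; rewrite -{1}(gK x) -{1}(gK y) -fl fK.
split=> // [y|y]; last by rewrite -[in RHS](gK y) fe.
have bg : bilin (fun a b => g a ⊗ g b) by exact/bilin_comp/gl/gl/tens_bilin.
rewrite -[in RHS](gK y) fD (sw_sw _ _ bg) -[LHS]sw_id; apply: eq_tlift => a b.
by rewrite tlift_tens // !fK.
Qed.

Theorem theorem2p8 (k : fieldType) (char0 : [pchar k] =i pred0)
    (H K : hopfAlgType k)
    (H_connected : coalg_connected H) (H_cocommutative : cocommutative H)
    (K_connected : coalg_connected K) (K_cocommutative : cocommutative K)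
    (act : module_bialgebra_action H K)
    (pi : H -> K) (pi_crossed : crossed_hom act pi) :
  exists pibar : uea (prim H) -> uea (prim K),
    unique (fun f : uea (prim H) -> uea (prim K) =>
      crossed_hom (uea_action (prim_action act)) f /\
      [/\ (\val : prim K -> K) \o crossed_hom_restr pi_crossed
            =1 pi \o (\val : prim H -> H),
          uea_in \o crossed_hom_restr pi_crossed =1 f \o uea_in,
          milnor_moore H \o uea_in =1 (\val : prim H -> H),
          milnor_moore K \o uea_in =1 (\val : prim K -> K) &
          milnor_moore K \o f =1 pi \o milnor_moore H]) pibar /\
    crossed_hom_iso (uea_action (prim_action act)) act pibar pi
      (milnor_moore K) (milnor_moore H).
Proof.
have bijH := milnor_moore_bijective char0 H_connected H_cocommutative.
have bijK := milnor_moore_bijective char0 K_connected K_cocommutative.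
have [psi phiK psiK] := bijK.
have phiC (M : hopfAlgType k) := @milnor_moore_coalgebra_hom k M.
have psiC := coalgebra_hom_inv (phiC K) phiK psiK.
have phil (M : hopfAlgType k) := @milnor_moore_linear k M.
have [piC piM] := pi_crossed.
pose pibar u := psi (pi (milnor_moore H u)).
have pibarE u : milnor_moore K (pibar u) = pi (milnor_moore H u) by exact: psiK.
have pibar_crossed : crossed_hom (uea_action (prim_action act)) pibar.
  split; first exact: (coalgebra_hom_comp psiC (coalgebra_hom_comp piC (phiC H))).
  move=> a b; apply: (bij_inj bijK); rewrite pibarE milnor_mooreM piM.
  rewrite (coalgebra_hom_comul (phiC H)) (linear_tlift _ _ (phil K)).
  have bF : bilin (fun a1 a2 => pi a1 * act a2 (pi (milnor_moore H b))).
    have pil := coalgebra_hom_linear piC.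
    split=> u c v w /=; first by rewrite pil mulrDl scalerAl.
    by rewrite ((mba_bilinear act).1 _) mulrDr scalerAr.
  rewrite (sw_sw _ _ bF); apply: eq_tlift => a1 a2; rewrite tlift_tens //.
  by rewrite milnor_mooreM milnor_moore_uact !pibarE.
exists pibar; split; last first.
  split=> //; split=> //; [exact: milnor_moore_hopf_hom..|exact: milnor_moore_uact].
split.
  split=> //; split=> // x /=; rewrite ?milnor_moore_in //.
  by apply: (bij_inj bijK); rewrite pibarE !milnor_moore_in.
move=> f [_ [_ _ _ _ fE]]; apply/funext => u; apply: (bij_inj bijK).
by rewrite pibarE -[RHS]/((milnor_moore K \o f) u) fE.
Qed.
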